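(* The tangent vector to the space of integrable circle patterns along the curve consisting of the patterns $w^{2a-1}$ (parametrized by the exponent $2a-1$), at the isoradial point corresponding to $a=1/2$ (where $w\equiv1$), is the discrete logarithmic function $\ell$; that is, $$\ell(\boldsymbol{n})=\Big(\frac12\frac{d}{da}\,w^{2a-1}(\boldsymbol{n})\Big)_{a=1/2}\qquad\text{for all }\boldsymbol{n}\in\widetilde{S}.$$
   Context: Let $\theta_1,\ldots,\theta_d\in\mathbb{S}^1$ be such that $\theta_1,\ldots,\theta_d,-\theta_1,\ldots,-\theta_d$ are distinct and occur in this circular (counterclockwise) order on the unit circle. Put $\theta_{k+d}=-\theta_k$ and extend $\theta_r$ to $r\in\mathbb{Z}$ by $2d$-periodicity. Choose $\gamma_r\in\mathbb{R}$ with $\theta_r=\exp(i\gamma_r)$, $\gamma_{r+1}-\gamma_r\in(0,\pi)$, and set $\log\theta_r=i\gamma_r$. Let $\boldsymbol{e}_1,\ldots,\boldsymbol{e}_d$ be the unit vectors of $\mathbb{Z}^d$, $\boldsymbol{e}_{k+d}=-\boldsymbol{e}_k$, extended by $2d$-periodicity. $S_m$ is the octant of $\boldsymbol{n}=\sum_{r=m}^{m+d-1}n_r\boldsymbol{e}_r$ with integers $n_r\ge0$; $\widetilde{S}_m$ is $S_m$ equipped with the values $\log\theta_r=i\gamma_r$, $r\in[m,m+d-1]$; $\widetilde{S}=\bigcup_m\widetilde{S}_m$, glued along common semi-axes with matching $\log\theta_r$. Discrete logarithmic function: for $\boldsymbol{n}\in\widetilde{S}_m$, $\ell(\boldsymbol{n})=\frac{1}{2\pi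 i}\int_\Gamma\frac{\log(\lambda)}{2\lambda}\prod_{r=m}^{m+d-1}\Big(\frac{\lambda+\theta_r}{\lambda-\theta_r}\Big)^{n_r}d\lambda$, where $\Gamma$ consists of $d$ small counterclockwise loops around $\theta_m,\ldots,\theta_{m+d-1}$, with the branch of $\log\lambda$ near $\theta_r$ satisfying $\log\theta_r=i\gamma_r$. The discrete $w^{2a-1}$, $a\in(0,1)$, is the solution $w$ on $\widetilde{S}$ of the Hirota system $$\theta_jw(\boldsymbol{n})w(\boldsymbol{n}+\boldsymbol{e}_j)+\theta_kw(\boldsymbol{n}+\boldsymbol{e}_j)w(\boldsymbol{n}+\boldsymbol{e}_j+\boldsymbol{e}_k)-\theta_jw(\boldsymbol{n}+\boldsymbol{e}_j+\boldsymbol{e}_k)w(\boldsymbol{n}+\boldsymbol{e}_k)-\theta_kw(\boldsymbol{n}+\boldsymbol{e}_k)w(\boldsymbol{n})=0$$ (on each $\widetilde{S}_m$, $j\ne k$ in $[m,m+d-1]$) defined by the values on the coordinate semi-axes $w_n=w(n\boldsymbol{e}_r)$, $r\in[m,m+d-1]$, which solve $n\,\frac{w_{n+1}-w_{n-1}}{w_{n+1}+w_{n-1}}=(a-\frac12)(1-(-1)^n)$ ($n\ge1$) with $w_0=w(\boldsymbol{0})=1$, $w_1=w(\boldsymbol{e}_r)=\theta_r^{2a-1}=\exp((2a-1)\log\theta_r)$; explicitly, $w_{2n}=\prod_{k=1}^n\frac{k-1+a}{k-a}$, $w_{2n+1}=\theta_r^{2a-1}$. For $a$ near $1/2$ the value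 $w^{2a-1}(\boldsymbol{n})$ at any given $\boldsymbol{n}$ is well defined by the Hirota system from these data. Integrable circle patterns correspond to solutions of the Hirota system, the isoradial one to $w\equiv1$. *)

(* Defs.v *)
From Stdlib Require Import Reals ZArith List.
From Coquelicot Require Import Coquelicot.

Open Scope R_scope.

Definition Cexp (z : C) : C :=
  (RtoC (exp (Re z)) * (cos (Im z), sin (Im z)))%C.

Definition Csum (f : Z -> C) (s : list Z) : C := fold_right Cplus (RtoC 0) (map f s).
Definition Cprod (f : Z -> C) (s : list Z) : C := fold_right Cmult (RtoC 1) (map f s).

Definition circle_integral (f : C -> C) (c : C) (rho : R) : C :=
  RInt (V := C_R_CompleteNormedModule)
    (fun t => (f (c + rho * Cexp (Ci * t)) * (rho * Ci * Cexp (Ci * t)))%C)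
    0 (2 * PI).

(** [theta 1, ..., theta N] are distinct points of the unit circle which occur
    in this order during one counterclockwise turn. *)
Definition circular_order (N : nat) (theta : Z -> C) : Prop :=
  exists alpha : Z -> R,
    (forall k, (1 <= k <= Z.of_nat N)%Z -> theta k = Cexp (Ci * alpha k)%C) /\
    (forall k, (1 <= k < Z.of_nat N)%Z -> alpha k < alpha (k + 1)%Z) /\
    alpha (Z.of_nat N) < alpha 1%Z + 2 * PI.

(** The data [theta], [gamma], already extended to all integer indices.  The
    rule [theta (r + d) = - theta r] contains both the definition of
    [theta (k + d)] for [1 <= k <= d] and the [2d]-periodicity. *)
Record directions (d : nat) (theta : Z -> C) (gamma : Z -> R) : Prop := {
  dir_unit : forall r, Cmod (theta r) = 1;
  dir_opp : forall r, theta (r + Z.of_nat d)%Z = Copp (theta r);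
  dir_order : circular_order (2 * d) theta;
  dir_gamma : forall r, theta r = Cexp (Ci * gamma r)%C;
  dir_step : forall r, 0 < gamma (r + 1)%Z - gamma r < PI
}.

(** The indices [m, ..., m + d - 1]. *)
Definition in_window (d : nat) (m r : Z) : Prop := (m <= r < m + Z.of_nat d)%Z.
Definition window (d : nat) (m : Z) : list Z :=
  map (fun i => (m + Z.of_nat i)%Z) (seq 0 d).

(** A point of the branched covering is encoded by its coordinates
    [nu : Z -> nat]: it lies in the [m]-th octant when its support is contained
    in [[m, m + d - 1]], and it then stands for the lattice point
    [sum_(m <= r < m + d) nu r * e_r].  As [e_m, ..., e_(m + d - 1)] is a basis
    of [Z^d], each octant of [Z^d] is represented faithfully.  Points of two
    octants are the same [nu] exactly when all their nonzero coordinates have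
    the same indices [r], i.e. the octants are glued along the common semi-axes
    carrying the same logarithm [i * gamma r]; [e_r] and [e_(r + 2d)], equal in
    [Z^d] but carrying different logarithms, remain distinct. *)
Definition point := Z -> nat.

Definition in_octant (d : nat) (m : Z) (nu : point) : Prop :=
  forall r, ~ in_window d m r -> nu r = 0%nat.

Definition in_cover (d : nat) (nu : point) : Prop := exists m, in_octant d m nu.

Definition shift (nu : point) (r : Z) : point :=
  fun s => if Z.eq_dec s r then S (nu s) else nu s.

Definition axis (r : Z) (n : nat) : point :=
  fun s => if Z.eq_dec s r then n else 0%nat.

(** The unit disc around a point of the unit circle does not contain 0, so it
    carries exactly one such branch. *)
Definition log_branch (theta : C) (gamma : R) (L : C -> C) : Prop :=
  (forall z, Cmod (z - theta)%C < 1 ->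
     continuous (T := C_UniformSpace) (U := C_UniformSpace) L z /\ Cexp (L z) = z) /\
  L theta = (Ci * gamma)%C.

(** The circle of radius [rho] around [theta r] encloses no other [theta s] of
    the octant, and stays in the domain of the branch of the logarithm. *)
Definition small_loops (d : nat) (theta : Z -> C) (m : Z) (rho : R) : Prop :=
  0 < rho < 1 /\
  forall r s, in_window d m r -> in_window d m s -> r <> s ->
    rho < Cmod (theta r - theta s)%C.

(** [L r] is the branch of the logarithm used on the loop around [theta r]. *)
Definition discrete_log (d : nat) (theta : Z -> C) (L : Z -> C -> C)
    (rho : R) (m : Z) (nu : point) : C :=
  (/ (2 * PI * Ci) *
   Csum (fun r =>
     circle_integral
       (fun z => L r z / (2 * z) *
          Cprod (fun s => Cpow ((z + theta s) / (z - theta s)) (nu s)) (window d m))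
       (theta r) rho) (window d m))%C.

Definition hirota_eq (theta : Z -> C) (w : point -> C) (nu : point) (j k : Z) : Prop :=
  (theta j * w nu * w (shift nu j)
   + theta k * w (shift nu j) * w (shift (shift nu j) k)
   - theta j * w (shift (shift nu j) k) * w (shift nu k)
   - theta k * w (shift nu k) * w nu)%C = RtoC 0.

(** The condition [<> 0] is implicit in the fraction: division by 0 is total
    here. *)
Definition power_axis_data (gamma : Z -> R) (a : R) (w : point -> C) : Prop :=
  forall r,
    w (axis r 0) = RtoC 1 /\
    w (axis r 1) = Cexp ((2 * a - 1) * (Ci * gamma r))%C /\
    forall n, (1 <= n)%nat ->
      (w (axis r (n + 1)) + w (axis r (n - 1)))%C <> RtoC 0 /\
      (INR n * ((w (axis r (n + 1)) - w (axis r (n - 1)))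
                / (w (axis r (n + 1)) + w (axis r (n - 1)))))%C
      = RtoC ((a - 1 / 2) * (1 - (-1) ^ n)).

(** The curve [a |-> w a = w^(2a - 1)].  Each Hirota equation is required for
    all [a] near [1/2], with a neighbourhood which may depend on the equation:
    the recursive computation of the value at a given point uses finitely many
    equations, hence is legitimate for [a] close enough to [1/2]. *)
Definition discrete_power (d : nat) (theta : Z -> C) (gamma : Z -> R)
    (w : R -> point -> C) : Prop :=
  (forall a, 0 < a < 1 -> power_axis_data gamma a (w a)) /\
  (forall m nu j k, in_octant d m nu -> in_window d m j -> in_window d m k ->
     j <> k -> locally (1 / 2) (fun a => hirota_eq theta (w a) nu j k)).

(* Main.v *)
(** At [w = 1] the linearized Hirota equation reads
    [g(n + e_j + e_k) = g(n) + (theta_j + theta_k) / (theta_j - theta_k) * (g(n + e_j) - g(n + e_k))].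
    The derivative of [w^(2a - 1)] at [a = 1/2] satisfies it, and so does [l], because
    already the integrands do.  Hence it suffices to compare the two on the semi-axes.
    There only the loop around [theta_r] contributes to [l], by Cauchy's theorem, and
    integration by parts gives [l((n + 2) e_r) - l(n e_r) = (1 - (-1)^(n + 1)) / (n + 1)],
    with [l(0) = 0] and [l(e_r) = i gamma_r] by Cauchy's formula; half the derivative of
    the explicit axis values obeys the same recursion.

    Existence and local uniqueness of [w^(2a - 1)] come from the three-dimensional
    consistency of the Hirota equation: the value at a point computed from any two of its
    nonzero coordinates is the same, as long as the denominators, which tend to
    [theta_k - theta_j], do not vanish. *)

From Stdlib Require Import Reals ZArith List Lra Lia.
From Stdlib Require Import FunctionalExtensionality ClassicalEpsilon.
From Coquelicot Require Import Coquelicot.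
Require Import Defs.

Open Scope R_scope.

(** * Differentiation of complex-valued functions *)

(** The curve [w^(2a - 1)] is controlled only as a germ at [a = 1/2]: from point to point the
    interval on which no denominator of the computation vanishes may shrink. Hence the recursion is
    recorded as a relation between a point and a function of [a], and its results are compared on
    neighbourhoods of [1/2]. The relation mentions no octant, so the gluing along common faces is
    automatic.

    A point with several nonzero coordinates can be reached by many last steps. Two of them are
    compared through a third one that shares a direction with each; sharing a direction reduces the
    comparison to a single cube.

    Of complex analysis, only circles centred at the [theta r] occur. Cauchy's formula at the centre
    of a circle is the mean value property, obtained by differentiating the average with respect to
    the radius, so no contour is deformed. As each loop stays in the domain of its branch [L r],
    most other integrals vanish because the integrand has an explicit primitive built from [L r];
    integration by parts is of this kind. *)

Section ComplexContinuity.

Context {T : UniformSpace}.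
Implicit Types (f g : T -> C) (x : T).

Definition Ccontinuous f x := continuous (T := T) (U := C_UniformSpace) f x.

Lemma Ccontinuous_pair (f1 f2 : T -> R) x :
  continuous f1 x -> continuous f2 x -> Ccontinuous (fun y => (f1 y, f2 y)) x.
Proof.
  intros H1 H2.
  apply (continuous_comp_2 (V := R_UniformSpace) (W := R_UniformSpace)
           f1 f2 (fun a b => (a, b) : C_UniformSpace)); auto.
  apply (continuous_ext (fun z => z)); [now intros [] | apply continuous_id].
Qed.

Lemma Ccontinuous_fst f x : Ccontinuous f x -> continuous (fun y => fst (f y)) x.
Proof.
  intros H. apply (continuous_comp (V := C_UniformSpace) f fst); auto.
  destruct (f x). apply continuous_fst.
Qed.

Lemma Ccontinuous_snd f x : Ccontinuous f x -> continuous (fun y => snd (f y)) x.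
Proof.
  intros H. apply (continuous_comp (V := C_UniformSpace) f snd); auto.
  destruct (f x). apply continuous_snd.
Qed.

Lemma Ccontinuous_const c x : Ccontinuous (fun _ => c) x.
Proof. apply continuous_const. Qed.

Lemma Ccontinuous_plus f g x :
  Ccontinuous f x -> Ccontinuous g x -> Ccontinuous (fun y => f y + g y)%C x.
Proof.
  intros Hf Hg. apply Ccontinuous_pair;
    apply (continuous_plus (K := R_AbsRing) (V := R_NormedModule));
    auto using Ccontinuous_fst, Ccontinuous_snd.
Qed.

Lemma Ccontinuous_opp f x : Ccontinuous f x -> Ccontinuous (fun y => - f y)%C x.
Proof.
  intros Hf. apply Ccontinuous_pair;
    apply (continuous_opp (K := R_AbsRing) (V := R_NormedModule));
    auto using Ccontinuous_fst, Ccontinuous_snd.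
Qed.

Lemma Ccontinuous_minus f g x :
  Ccontinuous f x -> Ccontinuous g x -> Ccontinuous (fun y => f y - g y)%C x.
Proof. intros Hf Hg. apply Ccontinuous_plus; auto using Ccontinuous_opp. Qed.

Lemma Ccontinuous_mult f g x :
  Ccontinuous f x -> Ccontinuous g x -> Ccontinuous (fun y => f y * g y)%C x.
Proof.
  intros Hf Hg. apply Ccontinuous_pair.
  - apply (continuous_minus (K := R_AbsRing) (V := R_NormedModule));
      apply (continuous_mult (K := R_AbsRing));
      auto using Ccontinuous_fst, Ccontinuous_snd.
  - apply (continuous_plus (K := R_AbsRing) (V := R_NormedModule));
      apply (continuous_mult (K := R_AbsRing));
      auto using Ccontinuous_fst, Ccontinuous_snd.
Qed.

Lemma Cnorm2_neq0 (z : C) : z <> RtoC 0 -> fst z ^ 2 + snd z ^ 2 <> 0.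
Proof.
  intros Hz H. apply Hz. destruct z as [a b]; simpl in *.
  assert (a = 0) by nra. assert (b = 0) by nra. now subst.
Qed.

Lemma continuous_pow2 (u : T -> R) x : continuous u x -> continuous (fun y => u y ^ 2) x.
Proof.
  intros H. apply (continuous_ext (fun y => mult (u y) (u y))).
  - intros y. unfold mult; simpl. ring.
  - now apply (continuous_mult (K := R_AbsRing)).
Qed.

Lemma Ccontinuous_inv f x :
  Ccontinuous f x -> f x <> RtoC 0 -> Ccontinuous (fun y => / f y)%C x.
Proof.
  intros Hf H0.
  assert (Hn : continuous (fun y => / (fst (f y) ^ 2 + snd (f y) ^ 2)) x).
  { apply (continuous_comp (fun y => fst (f y) ^ 2 + snd (f y) ^ 2) Rinv);
      [|now apply continuous_Rinv, Cnorm2_neq0].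
    apply (continuous_plus (K := R_AbsRing) (V := R_NormedModule));
      apply continuous_pow2; auto using Ccontinuous_fst, Ccontinuous_snd. }
  apply Ccontinuous_pair; apply (continuous_mult (K := R_AbsRing)); auto.
  - now apply Ccontinuous_fst.
  - apply (continuous_opp (K := R_AbsRing) (V := R_NormedModule)).
    now apply Ccontinuous_snd.
Qed.

Lemma Ccontinuous_neq0 f x :
  Ccontinuous f x -> f x <> RtoC 0 -> locally x (fun y => f y <> RtoC 0).
Proof.
  intros Hf H0. apply (Hf (fun z => z <> RtoC 0)).
  destruct (f x) as [a b].
  assert (Hab : a <> 0 \/ b <> 0).
  { destruct (Req_dec a 0); auto. destruct (Req_dec b 0); auto. subst. now elim H0. }
  destruct Hab as [Ha | Hb].
  - exists (mkposreal (Rabs a) (Rabs_pos_lt _ Ha)).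
    intros [u v] [Hu _] E. injection E as Eu Ev. subst.
    unfold ball in Hu; simpl in Hu; unfold AbsRing_ball, abs, minus, plus, opp in Hu.
    simpl in Hu. replace (0 + - a) with (- a) in Hu by ring.
    rewrite Rabs_Ropp in Hu. lra.
  - exists (mkposreal (Rabs b) (Rabs_pos_lt _ Hb)).
    intros [u v] [_ Hv] E. injection E as Eu Ev. subst.
    unfold ball in Hv; simpl in Hv; unfold AbsRing_ball, abs, minus, plus, opp in Hv.
    simpl in Hv. replace (0 + - b) with (- b) in Hv by ring.
    rewrite Rabs_Ropp in Hv. lra.
Qed.

Lemma Ccontinuous_ext_loc f g x :
  locally x (fun y => f y = g y) -> Ccontinuous f x -> Ccontinuous g x.
Proof. apply continuous_ext_loc. Qed.

Lemma Ccontinuous_pow f n x : Ccontinuous f x -> Ccontinuous (fun y => f y ^ n)%C x.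
Proof.
  intros H. induction n; simpl; [apply Ccontinuous_const | now apply Ccontinuous_mult].
Qed.

End ComplexContinuity.

Lemma Ccontinuous_comp {T U : UniformSpace} (f : T -> U) (g : U -> C) (x : T) :
  continuous f x -> Ccontinuous g (f x) -> Ccontinuous (fun y => g (f y)) x.
Proof. apply (continuous_comp f (g : U -> C_UniformSpace)). Qed.

Lemma Ccontinuous_id (z : C_UniformSpace) : Ccontinuous (fun y => y) z.
Proof. apply continuous_id. Qed.

Lemma Ccontinuous_RtoC (x : R) : Ccontinuous RtoC x.
Proof. apply Ccontinuous_pair; [apply continuous_id | apply continuous_const]. Qed.

(** One set of differentiation rules serves both the real parameter [a] and the complex variable
    [z]: the rules use nothing about the coordinate but its continuity. *)
Class Ccoordinate {T : UniformSpace} (p : T -> C) :=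
  Ccoordinate_continuous : forall x, Ccontinuous p x.

#[export] Instance Ccoordinate_RtoC : Ccoordinate (T := R_UniformSpace) RtoC :=
  Ccontinuous_RtoC.

#[export] Instance Ccoordinate_id : Ccoordinate (T := C_UniformSpace) (fun z => z) :=
  Ccontinuous_id.

Section Derivative.

Context {T : UniformSpace} (p : T -> C) {p_coordinate : Ccoordinate p}.
Implicit Types (f g : T -> C) (x : T) (D : C).

(** Caratheodory's form of differentiability with respect to the coordinate [p]:
    [T] is [R] with [p = RtoC], or [C] with [p] the identity. *)
Definition has_derivative f x D :=
  exists phi : T -> C, Ccontinuous phi x /\ phi x = D /\
    locally x (fun y => f y = f x + (p y - p x) * phi y)%C.

Lemma has_derivative_continuous f x D : has_derivative f x D -> Ccontinuous f x.
Proof.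
  intros (phi & Hc & _ & E).
  apply (Ccontinuous_ext_loc (fun y => f x + (p y - p x) * phi y)%C).
  - apply filter_imp with (2 := E). now intros.
  - apply Ccontinuous_plus; [apply Ccontinuous_const|].
    apply Ccontinuous_mult; auto.
    apply Ccontinuous_minus; [apply p_coordinate | apply Ccontinuous_const].
Qed.

Lemma has_derivative_eq f x D D' : D = D' -> has_derivative f x D -> has_derivative f x D'.
Proof. now intros ->. Qed.

Lemma has_derivative_ext_loc f g x D :
  locally x (fun y => f y = g y) -> has_derivative f x D -> has_derivative g x D.
Proof.
  intros E (phi & Hc & H0 & Hf). exists phi. repeat split; auto.
  pose proof (locally_singleton _ _ E) as Ex. simpl in Ex.
  generalize (filter_and _ _ E Hf). apply filter_imp. intros y [<- Hy]. now rewrite <- Ex.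
Qed.

Lemma has_derivative_const c x : has_derivative (fun _ => c) x (RtoC 0).
Proof.
  exists (fun _ => RtoC 0). repeat split; [apply Ccontinuous_const|].
  apply filter_forall. intros; ring.
Qed.

Lemma has_derivative_coord x : has_derivative p x (RtoC 1).
Proof.
  exists (fun _ => RtoC 1). repeat split; [apply Ccontinuous_const|].
  apply filter_forall. intros; ring.
Qed.

Lemma has_derivative_plus f g x D E :
  has_derivative f x D -> has_derivative g x E ->
  has_derivative (fun y => f y + g y)%C x (D + E).
Proof.
  intros (phi & Hc & H0 & Hf) (psi & Kc & K0 & Kf).
  exists (fun y => phi y + psi y)%C. split; [now apply Ccontinuous_plus|].
  split; [now rewrite H0, K0|].
  generalize (filter_and _ _ Hf Kf). apply filter_imp. intros y [-> ->]. ring.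
Qed.

Lemma has_derivative_mult f g x D E :
  has_derivative f x D -> has_derivative g x E ->
  has_derivative (fun y => f y * g y)%C x (D * g x + f x * E).
Proof.
  intros Hf Hg. pose proof (has_derivative_continuous _ _ _ Hg) as Cg.
  destruct Hf as (phi & Hc & H0 & Hf), Hg as (psi & Kc & K0 & Kf).
  exists (fun y => phi y * g y + f x * psi y)%C. split; [|split].
  - apply Ccontinuous_plus; apply Ccontinuous_mult; auto. apply Ccontinuous_const.
  - now rewrite H0, K0.
  - generalize (filter_and _ _ Hf Kf). apply filter_imp. intros y [-> ->]. ring.
Qed.

Lemma has_derivative_scal c f x D :
  has_derivative f x D -> has_derivative (fun y => c * f y)%C x (c * D).
Proof.
  intros Hf. eapply has_derivative_eq;
    [|apply has_derivative_mult; [apply has_derivative_const | exact Hf]].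
  cbv beta; ring.
Qed.

Lemma has_derivative_opp f x D :
  has_derivative f x D -> has_derivative (fun y => - f y)%C x (- D).
Proof.
  intros Hf. eapply has_derivative_eq;
    [|eapply has_derivative_ext_loc; [|apply (has_derivative_scal (- RtoC 1)%C _ _ _ Hf)]].
  - ring.
  - apply filter_forall. intros; ring.
Qed.

Lemma has_derivative_minus f g x D E :
  has_derivative f x D -> has_derivative g x E ->
  has_derivative (fun y => f y - g y)%C x (D - E).
Proof. intros. apply has_derivative_plus; auto using has_derivative_opp. Qed.

Lemma has_derivative_inv f x D :
  has_derivative f x D -> f x <> RtoC 0 ->
  has_derivative (fun y => / f y)%C x (- D / (f x * f x)).
Proof.
  intros Hf N. pose proof (has_derivative_continuous _ _ _ Hf) as Cf.
  pose proof (Ccontinuous_neq0 _ _ Cf N) as Nf.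
  destruct Hf as (phi & Hc & H0 & Hf).
  exists (fun y => - phi y * / (f x * f y))%C. split; [|split].
  - apply Ccontinuous_mult; [now apply Ccontinuous_opp|].
    apply Ccontinuous_inv; [|now apply Cmult_neq_0].
    apply Ccontinuous_mult; auto. apply Ccontinuous_const.
  - now rewrite H0.
  - generalize (filter_and _ _ Hf Nf). apply filter_imp. intros y [E Ny].
    assert (E' : ((p y - p x) * phi y = f y - f x)%C) by (rewrite E; ring).
    replace ((p y - p x) * (- phi y * / (f x * f y)))%C
      with (- ((p y - p x) * phi y) * / (f x * f y))%C by ring.
    rewrite E'. field. auto.
Qed.

Lemma has_derivative_div f g x D E :
  has_derivative f x D -> has_derivative g x E -> g x <> RtoC 0 ->
  has_derivative (fun y => f y / g y)%C x ((D * g x - f x * E) / (g x * g x)).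
Proof.
  intros Hf Hg N. eapply has_derivative_eq;
    [|apply has_derivative_mult; [exact Hf | apply has_derivative_inv; eauto]].
  cbv beta; field. auto.
Qed.

Lemma has_derivative_pow f n x D :
  has_derivative f x D ->
  has_derivative (fun y => f y ^ S n)%C x (INR (S n) * f x ^ n * D)%C.
Proof.
  intros Hf. induction n as [|n IH].
  - eapply has_derivative_eq;
      [|eapply has_derivative_ext_loc; [apply filter_forall|exact Hf]].
    + simpl. ring.
    + intros; simpl; ring.
  - eapply has_derivative_eq;
      [|apply (has_derivative_mult _ _ _ _ _ Hf IH)].
    rewrite (S_INR (S n)), RtoC_plus. simpl Cpow. ring.
Qed.

End Derivative.

Notation Rhas_derivative := (has_derivative (T := R_UniformSpace) RtoC).
Notation Chas_derivative := (has_derivative (T := C_UniformSpace) (fun z => z)).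

(** The slopes multiply: [g (f y) - g (f x) = (f y - f x) * psi (f y)]. No quotient is formed, so
    points with [f y = f x] need no separate treatment. *)
Lemma has_derivative_comp {T : UniformSpace} (p : T -> C) (f : T -> C) (g : C -> C) x D E :
  Ccontinuous f x ->
  has_derivative p f x D -> Chas_derivative g (f x) E ->
  has_derivative p (fun y => g (f y)) x (D * E).
Proof.
  intros Cf (phi & Hc & H0 & Hf) (psi & Kc & K0 & Kf).
  exists (fun y => phi y * psi (f y))%C. split; [|split].
  - apply Ccontinuous_mult; auto.
    apply (Ccontinuous_comp (U := C_UniformSpace) f psi); auto.
  - now rewrite H0, K0.
  - apply Cf in Kf. generalize (filter_and _ _ Hf Kf). apply filter_imp.
    intros y [E1 E2]. simpl in E2. rewrite E2.
    assert (E' : ((p y - p x) * phi y = f y - f x)%C) by (rewrite E1; ring).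
    rewrite Cmult_assoc, E'. ring.
Qed.

Lemma is_derive_RtoC_coord (phi : R -> R) (f : R -> R) x D :
  continuous phi x -> phi x = D ->
  locally x (fun y => f y = f x + (y - x) * phi y) -> is_derive f x D.
Proof.
  intros Hc H0 Hf.
  apply (is_derive_ext_loc (K := R_AbsRing) (V := R_NormedModule)
    (fun y => f x + (y - x) * phi y)).
  { apply filter_imp with (2 := Hf). intros y Hy. now symmetry. }
  split; [apply is_linear_scal_l|].
  intros z Hz.
  apply (is_filter_lim_locally_unique (V := AbsRing_NormedModule R_AbsRing)) in Hz. subst z.
  intros eps. apply filterlim_locally with (eps := eps) in Hc.
  apply filter_imp with (2 := Hc). intros y Hy.
  unfold norm, minus, plus, opp, scal; simpl. unfold abs, mult; simpl.
  unfold ball in Hy; simpl in Hy; unfold AbsRing_ball, abs, minus, plus, opp in Hy; simpl in Hy.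
  replace (f x + (y - x) * phi y + - (f x + (x - x) * phi x) + - ((y + - x) * D))
    with ((phi y + - phi x) * (y + - x)) by (rewrite H0; ring).
  rewrite Rabs_mult. apply Rmult_le_compat_r; [apply Rabs_pos | now apply Rlt_le].
Qed.

Lemma has_derivative_Re f x D :
  Rhas_derivative f x D -> is_derive (fun y => fst (f y)) x (fst D).
Proof.
  intros (phi & Hc & H0 & Hf).
  apply (is_derive_RtoC_coord (fun y => fst (phi y))).
  - now apply (Ccontinuous_fst (T := R_UniformSpace)).
  - now rewrite H0.
  - apply filter_imp with (2 := Hf). intros y ->. simpl. ring.
Qed.

Lemma has_derivative_Im f x D :
  Rhas_derivative f x D -> is_derive (fun y => snd (f y)) x (snd D).
Proof.
  intros (phi & Hc & H0 & Hf).
  apply (is_derive_RtoC_coord (fun y => snd (phi y))).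
  - now apply (Ccontinuous_snd (T := R_UniformSpace)).
  - now rewrite H0.
  - apply filter_imp with (2 := Hf). intros y ->. simpl. ring.
Qed.

Lemma is_derive_pair (f : R -> C) (x : R) (D : C) :
  is_derive (fun y => fst (f y)) x (fst D) ->
  is_derive (fun y => snd (f y)) x (snd D) ->
  is_derive (K := R_AbsRing) (V := C_R_NormedModule) f x D.
Proof.
  intros H1 H2.
  apply (is_derive_ext (K := R_AbsRing) (V := C_R_NormedModule)
     (fun y => (fst (f y), snd (f y)))); [intros t; now destruct (f t)|].
  destruct D as [a b].
  eapply (filterdiff_ext_lin (K := R_AbsRing) (U := R_NormedModule) (V := C_R_NormedModule)
    _ (fun y => (scal y a, scal y b))).
  - refine (filterdiff_comp_2 (K := R_AbsRing) (T := R_NormedModule) (U := R_NormedModule)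
      (V := R_NormedModule) (W := C_R_NormedModule) (F := locally x)
      (fun y => fst (f y)) (fun y => snd (f y)) (fun a b => (a, b))
      (fun y => scal y a) (fun y => scal y b) (fun a b => (a, b)) H1 H2 _).
    apply (filterdiff_ext_lin _ (fun z => z)); [|now intros []].
    apply (filterdiff_ext (fun z => z)); [now intros []|]. apply filterdiff_id.
  - reflexivity.
Qed.

Lemma has_derivative_is_derive (f : R -> C) (x : R) (D : C) :
  Rhas_derivative f x D ->
  is_derive (K := R_AbsRing) (V := C_R_NormedModule) f x D.
Proof.
  intros H. apply is_derive_pair; [now apply has_derivative_Re | now apply has_derivative_Im].
Qed.

(** The balls of [C_UniformSpace] are squares; [norm_factor] compares them with the discs of
    [Cmod]. *)
Lemma Cball_Cmod (z : C) (eps : R) (He : 0 < eps) :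
  locally (T := C_UniformSpace) z (fun y => Cmod (y - z) < eps).
Proof.
  pose proof (@norm_factor_gt_0 C_AbsRing C_NormedModule) as Hf.
  assert (He' : 0 < eps / @norm_factor C_AbsRing C_NormedModule) by now apply Rdiv_lt_0_compat.
  exists (mkposreal _ He'). intros y Hy.
  apply (@norm_compat2 C_AbsRing C_NormedModule z y (mkposreal _ He')) in Hy.
  simpl in Hy. unfold minus, plus, opp in Hy; simpl in Hy.
  replace eps with (@norm_factor C_AbsRing C_NormedModule *
                      (eps / @norm_factor C_AbsRing C_NormedModule)) by (field; lra).
  exact Hy.
Qed.

Lemma Ccontinuous_Cmod {T : UniformSpace} (f : T -> C) (x : T) :
  Ccontinuous f x <-> forall eps, 0 < eps -> locally x (fun y => Cmod (f y - f x) < eps).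
Proof.
  split; intros H.
  - intros eps He. apply (H (fun z => Cmod (z - f x) < eps)). now apply Cball_Cmod.
  - intros P [eps HP].
    apply filter_imp with (2 := H eps (cond_pos eps)). intros y Hy. apply HP.
    now apply (@norm_compat1 C_AbsRing C_NormedModule).
Qed.

Lemma locally_disc (c z : C) (r : R) :
  Cmod (z - c) < r -> locally (T := C_UniformSpace) z (fun y => Cmod (y - c) < r).
Proof.
  intros H. assert (He : 0 < r - Cmod (z - c)) by lra.
  apply filter_imp with (2 := Cball_Cmod z _ He). intros y Hy.
  replace (y - c)%C with ((y - z) + (z - c))%C by ring.
  pose proof (Cmod_triangle (y - z) (z - c)). lra.
Qed.

Lemma is_derive_Rhas_derivative (f : R -> R) (x D : R) :
  is_derive f x D -> Rhas_derivative (fun y => RtoC (f y)) x (RtoC D).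
Proof.
  intros H.
  set (phi := fun y => if Req_EM_T y x then D else (f y - f x) / (y - x)).
  exists (fun y => RtoC (phi y)).
  assert (Hx : phi x = D) by (unfold phi; now destruct (Req_EM_T x x)).
  split; [|split].
  - apply (Ccontinuous_comp (T := R_UniformSpace) (U := R_UniformSpace) phi RtoC);
      [|apply Ccontinuous_RtoC].
    apply filterlim_locally. intros eps. rewrite Hx.
    apply is_derive_Reals in H. destruct (H eps (cond_pos eps)) as [delta Hd].
    exists delta. intros y Hy. unfold phi.
    unfold ball in *; simpl in *; unfold AbsRing_ball, abs, minus, plus, opp in *; simpl in *.
    destruct (Req_EM_T y x) as [_|Hn].
    + replace (D + - D) with 0 by ring. rewrite Rabs_R0. apply cond_pos.
    + assert (Hn' : y + - x <> 0) by lra.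
      specialize (Hd _ Hn' Hy). replace (x + (y + - x)) with y in Hd by ring.
      exact Hd.
  - now rewrite Hx.
  - apply filter_forall. intros y. rewrite <- RtoC_minus, <- RtoC_mult, <- RtoC_plus.
    f_equal. unfold phi. destruct (Req_EM_T y x) as [->|Hn]; [ring|field; lra].
Qed.

(** * The complex exponential and the branches of the logarithm *)

Lemma Cexp_plus (z w : C) : Cexp (z + w) = (Cexp z * Cexp w)%C.
Proof.
  destruct z as [a b], w as [c e]. unfold Cexp; simpl. unfold Cmult; simpl.
  rewrite exp_plus, cos_plus, sin_plus. f_equal; ring.
Qed.

Lemma Cexp_0 : Cexp (RtoC 0) = RtoC 1.
Proof.
  unfold Cexp; simpl. rewrite exp_0, cos_0, sin_0.
  unfold Cmult, RtoC; simpl. f_equal; ring.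
Qed.

Lemma Cexp_neq0 (z : C) : Cexp z <> RtoC 0.
Proof.
  intros E. apply C1_nz. rewrite <- Cexp_0.
  replace (RtoC 0) with (z + - z)%C at 1 by ring. rewrite Cexp_plus, E. ring.
Qed.

(** With the real slopes [u] of [exp] and [v] of [cos + i sin] at 0,
    [Cexp (x + i y) - 1 = x * A + y * B], where [A] tends to 1 and [B] to [i]. Dividing by
    [h = x + i y], the quotient differs from 1 by [(x / h) * (A - 1) + (y / h) * (B - i)], and both
    [x / h] and [y / h] have modulus at most 1. *)
Lemma Chas_derivative_Cexp_0 : Chas_derivative Cexp (RtoC 0) (RtoC 1).
Proof.
  assert (He : Rhas_derivative (fun y => RtoC (exp y)) 0 (RtoC 1)).
  { apply is_derive_Rhas_derivative. rewrite <- exp_0. apply is_derive_exp. }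
  assert (Ht : Rhas_derivative (fun y => (RtoC (cos y) + Ci * RtoC (sin y))%C) 0 Ci).
  { pose proof (is_derive_Rhas_derivative _ _ _ (is_derive_cos 0)) as Hc.
    pose proof (is_derive_Rhas_derivative _ _ _ (is_derive_sin 0)) as Hs.
    eapply has_derivative_eq;
      [|exact (has_derivative_plus _ _ _ _ _ _ Hc (has_derivative_scal _ Ci _ _ _ Hs))].
    rewrite sin_0, cos_0, Ropp_0. ring. }
  destruct He as (u & Cu & Eu & Lu), Ht as (v & Cv & Ev & Lv).
  set (A := fun h : C => (u (fst h) * (cos (snd h), sin (snd h)))%C).
  set (B := fun h : C => v (snd h)).
  assert (Fst : continuous (T := C_UniformSpace) (U := R_UniformSpace) fst (RtoC 0))
    by apply continuous_fst.
  assert (Snd : continuous (T := C_UniformSpace) (U := R_UniformSpace) snd (RtoC 0))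
    by apply continuous_snd.
  assert (CB : Ccontinuous (T := C_UniformSpace) B (RtoC 0)).
  { apply (Ccontinuous_comp (T := C_UniformSpace) (U := R_UniformSpace) snd v); auto. }
  assert (CA : Ccontinuous (T := C_UniformSpace) A (RtoC 0)).
  { apply Ccontinuous_mult.
    - apply (Ccontinuous_comp (T := C_UniformSpace) (U := R_UniformSpace) fst u); auto.
    - apply Ccontinuous_pair.
      + apply (continuous_comp (V := R_UniformSpace) snd cos); auto. apply continuous_cos.
      + apply (continuous_comp (V := R_UniformSpace) snd sin); auto. apply continuous_sin. }
  assert (A0 : A (RtoC 0) = RtoC 1).
  { unfold A; simpl. rewrite Eu, cos_0, sin_0. change (1, 0) with (RtoC 1). ring. }
  assert (B0 : B (RtoC 0) = Ci) by (unfold B; simpl; apply Ev).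
  set (e := fun h : C => if Ceq_dec h (RtoC 0) then RtoC 1 else ((Cexp h - 1) / h)%C).
  assert (e0 : e (RtoC 0) = RtoC 1) by (unfold e; now destruct (Ceq_dec 0 0)).
  assert (Dec : locally (T := C_UniformSpace) (RtoC 0) (fun h =>
     Cexp h - 1 = RtoC (fst h) * A h + RtoC (snd h) * B h)%C).
  { apply Fst in Lu. apply Snd in Lv. unfold filtermap in Lu, Lv.
    apply filter_imp with (2 := filter_and _ _ Lu Lv). intros [x y] [E1 E2]. simpl in *.
    unfold Cexp, A, B; simpl.
    replace (cos y, sin y) with (RtoC (cos y) + Ci * RtoC (sin y))%C
      by (unfold Cplus, Cmult; simpl; f_equal; ring).
    rewrite E1, exp_0. rewrite sin_0, cos_0 in E2.
    replace (RtoC y * v y)%C with ((RtoC (cos y) + Ci * RtoC (sin y)) - 1)%C.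
    - ring.
    - rewrite E2. ring. }
  exists e. split; [|split; auto].
  - apply Ccontinuous_Cmod. intros eps He. rewrite e0.
    rewrite Ccontinuous_Cmod in CA, CB.
    assert (He2 : 0 < eps / 2) by lra.
    generalize (filter_and _ _ Dec (filter_and _ _ (CA _ He2) (CB _ He2))).
    apply filter_imp. intros h (E & HA & HB). rewrite A0 in HA. rewrite B0 in HB.
    unfold e. destruct (Ceq_dec h 0) as [->|Hh].
    + replace (1 - 1)%C with (RtoC 0) by ring. now rewrite Cmod_0.
    + rewrite E.
      assert (Eh : h = (RtoC (fst h) + Ci * RtoC (snd h))%C).
      { destruct h; unfold Cplus, Cmult; simpl; f_equal; ring. }
      replace ((RtoC (fst h) * A h + RtoC (snd h) * B h) / h - 1)%C
        with ((RtoC (fst h) / h) * (A h - 1) + (RtoC (snd h) / h) * (B h - Ci))%C.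
      2: { transitivity ((RtoC (fst h) * A h + RtoC (snd h) * B h) / h
              - (RtoC (fst h) + Ci * RtoC (snd h)) / h)%C; [field; auto|].
           rewrite <- Eh. field; auto. }
      pose proof (proj1 (Cmod_gt_0 h) Hh) as Hp.
      assert (Hq : forall q, Rabs q <= Cmod h -> Cmod (RtoC q / h) <= 1).
      { intros q Hq. rewrite Cmod_div, Cmod_R; auto.
        apply (Rmult_le_reg_r (Cmod h)); auto. field_simplify; lra. }
      eapply Rle_lt_trans; [apply Cmod_triangle|]. rewrite !Cmod_mult.
      pose proof (Rmax_Cmod h) as Hm.
      assert (H1 := Hq _ (Rle_trans _ _ _ (Rmax_l _ _) Hm)).
      assert (H2 := Hq _ (Rle_trans _ _ _ (Rmax_r _ _) Hm)).
      pose proof (Cmod_ge_0 (A h - 1)). pose proof (Cmod_ge_0 (B h - Ci)).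
      apply Rle_lt_trans with (1 * Cmod (A h - 1) + 1 * Cmod (B h - Ci)).
      * apply Rplus_le_compat; apply Rmult_le_compat_r; auto.
      * lra.
  - apply filter_forall. intros h. rewrite Cexp_0. unfold e.
    destruct (Ceq_dec h 0) as [->|Hh]; [rewrite Cexp_0; ring|field; auto].
Qed.

Lemma Chas_derivative_Cexp (z : C) : Chas_derivative Cexp z (Cexp z).
Proof.
  apply has_derivative_ext_loc with (f := fun y => (Cexp z * Cexp (y - z))%C).
  { apply filter_forall. intros y. rewrite <- Cexp_plus. f_equal. ring. }
  eapply has_derivative_eq; [|apply (has_derivative_scal (T := C_UniformSpace) (fun z => z))].
  { apply Cmult_1_r. }
  eapply has_derivative_eq.
  2: apply (has_derivative_comp (T := C_UniformSpace) (fun z => z) (fun y => y - z)%C Cexp).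
  - apply (Cmult_1_r (RtoC 1)).
  - apply Ccontinuous_minus; [apply Ccontinuous_id | apply Ccontinuous_const].
  - eapply has_derivative_eq;
      [|apply (has_derivative_minus (T := C_UniformSpace) (fun z => z))].
    2: apply (has_derivative_coord (T := C_UniformSpace) (fun z => z)).
    2: apply has_derivative_const. ring.
  - replace (z - z)%C with (RtoC 0) by ring. apply Chas_derivative_Cexp_0.
Qed.

Section LogBranch.

Variables (theta : C) (gamma : R) (L : C -> C).
Hypothesis HL : log_branch theta gamma L.

Lemma log_branch_neq0 z : Cmod (z - theta) < 1 -> z <> RtoC 0.
Proof. intros H. rewrite <- (proj2 (proj1 HL z H)). apply Cexp_neq0. Qed.

(** Inverse function rule: if [phi] is the slope of [Cexp] at [L z], then
    [y - z = (L y - L z) * phi (L y)], so [1 / phi (L y)] is a slope of [L]. Continuity of [L] makes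
    it continuous at [z] and keeps it finite nearby. *)
Lemma log_branch_derivative z : Cmod (z - theta) < 1 -> Chas_derivative L z (/ z)%C.
Proof.
  intros Hz. destruct (proj1 HL z Hz) as [Cz Ez].
  destruct (Chas_derivative_Cexp (L z)) as (phi & Cphi & Ephi & Hphi).
  rewrite Ez in Ephi.
  assert (Cc : Ccontinuous (T := C_UniformSpace) (fun y => phi (L y)) z).
  { now apply (Ccontinuous_comp (T := C_UniformSpace) (U := C_UniformSpace) L phi). }
  pose proof (log_branch_neq0 z Hz) as Nz.
  assert (N : phi (L z) <> RtoC 0) by now rewrite Ephi.
  exists (fun y => / phi (L y))%C. split; [|split].
  - now apply Ccontinuous_inv.
  - now rewrite Ephi.
  - apply Cz in Hphi. unfold filtermap in Hphi.
    generalize (filter_and _ _ Hphi (filter_and _ _ (Ccontinuous_neq0 _ _ Cc N)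
      (locally_disc _ _ _ Hz))).
    apply filter_imp. intros y (E & Ny & Hy). simpl in E.
    rewrite Ez, (proj2 (proj1 HL y Hy)) in E.
    apply (f_equal (fun u => u - z)%C) in E. rewrite E. field. auto.
Qed.

End LogBranch.

(** * Integrals over circles *)

Lemma Cmod_Cexp_Ci (t : R) : Cmod (Cexp (Ci * t)) = 1.
Proof.
  unfold Cexp; simpl. rewrite Cmod_mult, Cmod_R.
  replace (0 * t - 1 * 0) with 0 by ring. replace (0 * 0 + 1 * t) with t by ring.
  rewrite exp_0, Rabs_R1, Rmult_1_l. unfold Cmod; simpl.
  replace (cos t * (cos t * 1) + sin t * (sin t * 1)) with 1.
  - apply sqrt_1.
  - generalize (sin2_cos2 t); unfold Rsqr; lra.
Qed.

Lemma Cexp_Ci_2PI : Cexp (Ci * (2 * PI)%R) = RtoC 1.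
Proof.
  unfold Cexp; simpl.
  replace (0 * (2 * PI) - 1 * 0) with 0 by ring.
  replace (0 * 0 + 1 * (2 * PI)) with (2 * PI) by ring.
  rewrite exp_0, cos_2PI, sin_2PI. change (1, 0) with (RtoC 1). ring.
Qed.

Lemma Cexp_Ci_0 : Cexp (Ci * 0) = RtoC 1.
Proof. rewrite Cmult_0_r. apply Cexp_0. Qed.

Lemma Rhas_derivative_Cexp_Ci (t : R) :
  Rhas_derivative (fun u : R => Cexp (Ci * u)) t (Ci * Cexp (Ci * t))%C.
Proof.
  apply (has_derivative_comp (T := R_UniformSpace) RtoC (fun u : R => Ci * u)%C Cexp).
  - apply Ccontinuous_mult; [apply Ccontinuous_const | apply Ccontinuous_RtoC].
  - eapply has_derivative_eq; [|apply (has_derivative_scal (T := R_UniformSpace) RtoC)].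
    2: apply (has_derivative_coord (T := R_UniformSpace) RtoC). ring.
  - apply Chas_derivative_Cexp.
Qed.

Lemma Ccontinuous_Cexp_Ci (t : R) :
  Ccontinuous (T := R_UniformSpace) (fun u : R => Cexp (Ci * u)) t.
Proof.
  apply (has_derivative_continuous (T := R_UniformSpace) RtoC _ _ _ (Rhas_derivative_Cexp_Ci t)).
Qed.

Notation is_CRInt := (is_RInt (V := C_R_NormedModule)).

(** The integral takes values in [C] as a real vector space, which only lets real factors out;
    complex factors are treated by coordinates. *)
Lemma is_CRInt_mult (f : R -> C) (a b : R) (c l : C) :
  is_CRInt f a b l -> is_CRInt (fun t => c * f t)%C a b (c * l)%C.
Proof.
  intros H.
  pose proof (is_RInt_fct_extend_fst f a b l H) as H1.
  pose proof (is_RInt_fct_extend_snd f a b l H) as H2.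
  apply (is_RInt_fct_extend_pair (fun t => (c * f t)%C)); simpl.
  - apply (is_RInt_minus (V := R_NormedModule));
      apply (is_RInt_scal (V := R_NormedModule)); auto.
  - apply (is_RInt_plus (V := R_NormedModule));
      apply (is_RInt_scal (V := R_NormedModule)); auto.
Qed.

Lemma is_CRInt_closed (F f : R -> C) :
  (forall t, Rhas_derivative F t (f t)) ->
  (forall t, Ccontinuous (T := R_UniformSpace) f t) ->
  F (2 * PI) = F 0 -> is_CRInt f 0 (2 * PI) (RtoC 0).
Proof.
  intros HF Hf E.
  replace (RtoC 0) with (minus (F (2 * PI) : C_R_CompleteNormedModule) (F 0)).
  - apply (is_RInt_derive (V := C_R_CompleteNormedModule)); intros t _.
    + apply has_derivative_is_derive, HF.
    + apply Hf.
  - rewrite E. unfold minus, plus, opp; simpl. destruct (F 0). unfold prod_plus, prod_opp; simpl.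
    unfold plus, opp, RtoC; simpl. f_equal; ring.
Qed.

Lemma Rhas_derivative_circle (g : C -> C) (c : C) (s t : R) (D : C) :
  Chas_derivative g (c + s * Cexp (Ci * t))%C D ->
  Rhas_derivative (fun u : R => g (c + s * Cexp (Ci * u))%C) t
    (s * Ci * Cexp (Ci * t) * D)%C.
Proof.
  apply (has_derivative_comp (T := R_UniformSpace) RtoC (fun u : R => c + s * Cexp (Ci * u))%C g).
  - apply Ccontinuous_plus; [apply Ccontinuous_const|].
    apply Ccontinuous_mult; [apply Ccontinuous_const | apply Ccontinuous_Cexp_Ci].
  - eapply has_derivative_eq; [|apply (has_derivative_plus (T := R_UniformSpace) RtoC)].
    2: apply has_derivative_const.
    2: apply (has_derivative_scal (T := R_UniformSpace) RtoC), Rhas_derivative_Cexp_Ci.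
    cbv beta; ring.
Qed.

Lemma Rhas_derivative_radius (g : C -> C) (c : C) (s t : R) (D : C) :
  Chas_derivative g (c + s * Cexp (Ci * t))%C D ->
  Rhas_derivative (fun u : R => g (c + u * Cexp (Ci * t))%C) s (D * Cexp (Ci * t))%C.
Proof.
  intros H. apply has_derivative_eq with (D := (Cexp (Ci * t) * D)%C); [ring|].
  revert H.
  apply (has_derivative_comp (T := R_UniformSpace) RtoC (fun u : R => c + u * Cexp (Ci * t))%C g).
  - apply Ccontinuous_plus; [apply Ccontinuous_const|].
    apply Ccontinuous_mult; [apply Ccontinuous_RtoC | apply Ccontinuous_const].
  - eapply has_derivative_eq; [|apply (has_derivative_plus (T := R_UniformSpace) RtoC)].
    2: apply has_derivative_const.
    2: apply (has_derivative_mult (T := R_UniformSpace) RtoC);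
       [apply (has_derivative_coord (T := R_UniformSpace) RtoC) | apply has_derivative_const].
    cbv beta; ring.
Qed.

(** * The mean value property *)

Section MeanValue.

Variables (g g' : C -> C) (c : C) (r0 : R).
Hypothesis Hg : forall z, Cmod (z - c) < r0 ->
  Chas_derivative g z (g' z) /\ Ccontinuous (T := C_UniformSpace) g' z.

Let pt (s t : R) : C := (c + s * Cexp (Ci * t))%C.

Lemma circle_in_disc (s t : R) : Rabs s < r0 -> Cmod (pt s t - c) < r0.
Proof.
  intros H. unfold pt.
  replace (c + s * Cexp (Ci * t) - c)%C with (s * Cexp (Ci * t))%C by ring.
  rewrite Cmod_mult, Cmod_R, Cmod_Cexp_Ci. lra.
Qed.

(** Up to the factor [s * Ci], the radial derivative is the angular derivative of [g (pt s t)],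
    whose integral over a full turn vanishes because the curve closes. *)
Lemma radial_derivative_closed (s : R) :
  Rabs s < r0 -> is_CRInt (fun t : R => g' (pt s t) * Cexp (Ci * t))%C 0 (2 * PI) (RtoC 0).
Proof.
  intros Hs.
  assert (Hc : forall t, Ccontinuous (T := R_UniformSpace)
      (fun t : R => g' (pt s t) * Cexp (Ci * t))%C t).
  { intros t. apply Ccontinuous_mult; [|apply Ccontinuous_Cexp_Ci].
    apply (Ccontinuous_comp (T := R_UniformSpace) (U := C_UniformSpace) (pt s) g').
    - apply Ccontinuous_plus; [apply Ccontinuous_const|].
      apply Ccontinuous_mult; [apply Ccontinuous_const | apply Ccontinuous_Cexp_Ci].
    - now apply Hg, circle_in_disc. }
  assert (HCi : Ci <> RtoC 0) by (intros E; apply (f_equal snd) in E; simpl in E; lra).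
  (* At [s = 0] the angular primitive would need a division by 0, but there the integrand is just
     the constant [g' c] times [Cexp (Ci * t)]. *)
  destruct (Req_dec s 0) as [->|Hs0].
  - apply is_CRInt_closed with (F := fun t : R => (g' c / Ci * Cexp (Ci * t))%C).
    + intros t. eapply has_derivative_eq;
        [|apply (has_derivative_scal (T := R_UniformSpace) RtoC), Rhas_derivative_Cexp_Ci].
      unfold pt. replace (c + 0 * Cexp (Ci * t))%C with c by ring. field. auto.
    + exact Hc.
    + now rewrite Cexp_Ci_0, Cexp_Ci_2PI.
  - assert (Hs1 : RtoC s <> RtoC 0) by (intros E; apply Hs0; now injection E).
    apply is_CRInt_closed with (F := fun t : R => (/ (s * Ci) * g (pt s t))%C).
    + intros t. eapply has_derivative_eq;
        [|apply (has_derivative_scal (T := R_UniformSpace) RtoC), Rhas_derivative_circle].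
      2: now apply Hg, circle_in_disc.
      unfold pt. field. auto.
    + exact Hc.
    + unfold pt. now rewrite Cexp_Ci_0, Cexp_Ci_2PI.
Qed.

(** The integral over the circle of radius [s] has derivative 0 in [s], by differentiation under the
    integral sign, hence equals its value at [s = 0]. That rule concerns real-valued integrands, so
    the argument runs for a real projection [pr], to be taken as [fst] and [snd]. *)
Lemma mean_value_projection (pr : C -> R) (rho : R) :
  (forall f x D, Rhas_derivative f x D -> is_derive (fun y => pr (f y)) x (pr D)) ->
  (forall (T : UniformSpace) (f : T -> C) x,
     Ccontinuous f x -> continuous (fun y => pr (f y)) x) ->
  (forall f a b l, is_CRInt f a b l -> is_RInt (fun t => pr (f t)) a b (pr l)) ->
  pr (RtoC 0) = 0 ->
  0 < rho < r0 ->
  is_RInt (fun t => pr (g (pt rho t))) 0 (2 * PI) (2 * PI * pr (g c)).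
Proof.
  intros Hder Hcont Hint H0 Hrho.
  assert (Hd : forall s t, Rabs s < r0 ->
    is_derive (fun u => pr (g (pt u t))) s (pr (g' (pt s t) * Cexp (Ci * t))%C)).
  { intros s t Hs. apply Hder, Rhas_derivative_radius. now apply Hg, circle_in_disc. }
  assert (Hex : forall s, Rabs s < r0 ->
    ex_RInt (V := R_CompleteNormedModule) (fun t => pr (g (pt s t))) 0 (2 * PI)).
  { intros s Hs. apply (ex_RInt_continuous (V := R_CompleteNormedModule)). intros t _.
    apply Hcont.
    eapply (has_derivative_continuous (T := R_UniformSpace) RtoC), Rhas_derivative_circle.
    now apply Hg, circle_in_disc. }
  assert (Hnear : forall s, Rabs s < r0 -> locally s (fun u => Rabs u < r0)).
  { intros s Hs. assert (He : 0 < r0 - Rabs s) by lra.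
    exists (mkposreal _ He). intros u Hu.
    unfold ball in Hu; simpl in Hu; unfold AbsRing_ball, abs, minus, plus, opp in Hu; simpl in Hu.
    pose proof (Rabs_triang_inv u s : Rabs u - Rabs s <= Rabs (u + - s)). lra. }
  set (G := fun s => RInt (fun t => pr (g (pt s t))) 0 (2 * PI)).
  assert (HG : forall s, Rabs s < r0 -> is_derive G s 0).
  { intros s Hs.
    replace 0 with (RInt (fun t => Derive (fun u => pr (g (pt u t))) s) 0 (2 * PI)).
    - apply (is_derive_RInt_param (fun s t => pr (g (pt s t)))).
      + apply filter_imp with (2 := Hnear s Hs). intros u Hu t _. eexists. now apply Hd.
      + intros t _.
        apply continuity_2d_pt_ext_loc with (f := fun u v => pr (g' (pt u v) * Cexp (Ci * v))%C).
        * destruct (Hnear s Hs) as [e He]. exists e. intros u v Hu _. symmetry.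
          apply is_derive_unique, Hd, He, Hu.
        * apply continuity_2d_pt_filterlim.
          apply (Hcont (prod_UniformSpace R_UniformSpace R_UniformSpace)
            (fun z => g' (pt (fst z) (snd z)) * Cexp (Ci * snd z))%C (s, t)).
          assert (Cs : continuous (T := prod_UniformSpace R_UniformSpace R_UniformSpace)
             (U := R_UniformSpace) snd (s, t)) by apply continuous_snd.
          assert (Cf : continuous (T := prod_UniformSpace R_UniformSpace R_UniformSpace)
             (U := R_UniformSpace) fst (s, t)) by apply continuous_fst.
          assert (Ce : Ccontinuous (T := prod_UniformSpace R_UniformSpace R_UniformSpace)
             (fun z => Cexp (Ci * snd z)) (s, t)).
          { apply (Ccontinuous_comp (U := R_UniformSpace) snd (fun u : R => Cexp (Ci * u))); auto.
            apply Ccontinuous_Cexp_Ci. }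
          apply Ccontinuous_mult; auto.
          apply (Ccontinuous_comp (U := C_UniformSpace) (fun z => pt (fst z) (snd z)) g').
          -- apply Ccontinuous_plus; [apply Ccontinuous_const|].
             apply Ccontinuous_mult; auto.
             apply (Ccontinuous_comp (U := R_UniformSpace) fst RtoC); auto.
             apply Ccontinuous_RtoC.
          -- simpl. now apply Hg, circle_in_disc.
      + apply filter_imp with (2 := Hnear s Hs). exact Hex.
    - apply (is_RInt_unique (V := R_CompleteNormedModule)).
      apply (is_RInt_ext (V := R_NormedModule)) with
        (f := fun t => pr (g' (pt s t) * Cexp (Ci * t))%C).
      + intros t _. symmetry. now apply is_derive_unique, Hd.
      + pose proof (Hint _ _ _ _ (radial_derivative_closed s Hs)) as Hr.
        rewrite H0 in Hr. exact Hr. }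
  assert (E : G 0 = G rho).
  { apply (eq_is_derive (V := R_NormedModule)); [|apply Hrho].
    intros s Hs. apply HG. rewrite Rabs_pos_eq; lra. }
  replace (2 * PI * pr (g c)) with (G rho).
  - apply (RInt_correct (V := R_CompleteNormedModule)). apply Hex. rewrite Rabs_pos_eq; lra.
  - rewrite <- E. unfold G. rewrite (RInt_ext _ (fun _ => pr (g c))).
    + rewrite RInt_const. unfold scal; simpl. unfold mult; simpl. ring.
    + intros t _. unfold pt. do 2 f_equal. ring.
Qed.

Lemma mean_value (rho : R) :
  0 < rho < r0 ->
  is_CRInt (fun t : R => g (c + rho * Cexp (Ci * t))%C) 0 (2 * PI) (2 * PI * g c)%C.
Proof.
  intros Hrho.
  replace (2 * PI * g c)%C with (2 * PI * fst (g c), 2 * PI * snd (g c))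
    by (unfold Cmult; simpl; f_equal; ring).
  apply (is_RInt_fct_extend_pair (fun t => g (c + rho * Cexp (Ci * t))%C)).
  - apply (mean_value_projection fst); auto.
    + apply has_derivative_Re.
    + intros. now apply Ccontinuous_fst.
    + intros f a b l H. apply (is_RInt_fct_extend_fst f a b l H).
  - apply (mean_value_projection snd); auto.
    + apply has_derivative_Im.
    + intros. now apply Ccontinuous_snd.
    + intros f a b l H. apply (is_RInt_fct_extend_snd f a b l H).
Qed.

End MeanValue.

Ltac change_eq_C :=
  cbv beta; match goal with |- @eq _ ?a ?b => change (@eq C a b) end.

Definition continuous_on_circle (f : C -> C) (c : C) (rho : R) :=
  forall t : R, Ccontinuous (T := C_UniformSpace) f (c + rho * Cexp (Ci * t))%C.

Lemma is_circle_integral (f : C -> C) (c : C) (rho : R) :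
  continuous_on_circle f c rho ->
  is_CRInt (fun t : R => f (c + rho * Cexp (Ci * t)) * (rho * Ci * Cexp (Ci * t)))%C
    0 (2 * PI) (circle_integral f c rho).
Proof.
  intros H. apply (RInt_correct (V := C_R_CompleteNormedModule)).
  apply (ex_RInt_continuous (V := C_R_CompleteNormedModule)). intros t _.
  apply (Ccontinuous_mult (T := R_UniformSpace)).
  - apply (Ccontinuous_comp (T := R_UniformSpace) (U := C_UniformSpace)
      (fun t : R => c + rho * Cexp (Ci * t))%C f); auto.
    apply Ccontinuous_plus; [apply Ccontinuous_const|].
    apply Ccontinuous_mult; [apply Ccontinuous_const | apply Ccontinuous_Cexp_Ci].
  - apply Ccontinuous_mult; [apply Ccontinuous_const | apply Ccontinuous_Cexp_Ci].
Qed.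

Lemma circle_integral_unique (f : C -> C) (c : C) (rho : R) (l : C) :
  is_CRInt (fun t : R => f (c + rho * Cexp (Ci * t)) * (rho * Ci * Cexp (Ci * t)))%C
    0 (2 * PI) l -> circle_integral f c rho = l.
Proof. apply (is_RInt_unique (V := C_R_CompleteNormedModule)). Qed.

Lemma circle_integral_ext (f g : C -> C) (c : C) (rho : R) :
  (forall t : R, f (c + rho * Cexp (Ci * t)) = g (c + rho * Cexp (Ci * t)))%C ->
  circle_integral f c rho = circle_integral g c rho.
Proof.
  intros H. apply (RInt_ext (V := C_R_CompleteNormedModule)). intros t _. now rewrite H.
Qed.

Lemma circle_integral_plus (f g : C -> C) (c : C) (rho : R) :
  continuous_on_circle f c rho -> continuous_on_circle g c rho ->
  circle_integral (fun z => f z + g z)%C c rho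
  = (circle_integral f c rho + circle_integral g c rho)%C.
Proof.
  intros Hf Hg. apply circle_integral_unique.
  eapply (is_RInt_ext (V := C_R_NormedModule));
    [|exact (is_RInt_plus (V := C_R_NormedModule) _ _ _ _ _ _
        (is_circle_integral _ _ _ Hf) (is_circle_integral _ _ _ Hg))].
  intros t _. change_eq_C. change (plus ?a ?b) with (Cplus a b). ring.
Qed.

Lemma circle_integral_scal (a : C) (f : C -> C) (c : C) (rho : R) :
  continuous_on_circle f c rho ->
  circle_integral (fun z => a * f z)%C c rho = (a * circle_integral f c rho)%C.
Proof.
  intros Hf. apply circle_integral_unique.
  eapply (is_RInt_ext (V := C_R_NormedModule));
    [|exact (is_CRInt_mult _ _ _ a _ (is_circle_integral _ _ _ Hf))].
  intros t _. change_eq_C. ring.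
Qed.

Lemma circle_integral_primitive (F f : C -> C) (c : C) (rho : R) :
  (forall t : R, Chas_derivative F (c + rho * Cexp (Ci * t))%C (f (c + rho * Cexp (Ci * t))%C)) ->
  continuous_on_circle f c rho ->
  circle_integral f c rho = RtoC 0.
Proof.
  intros HF Hf. apply circle_integral_unique.
  apply is_CRInt_closed with (F := fun t : R => F (c + rho * Cexp (Ci * t))%C).
  - intros t. eapply has_derivative_eq; [|apply Rhas_derivative_circle, HF]. ring.
  - intros t. apply Ccontinuous_mult.
    + apply (Ccontinuous_comp (T := R_UniformSpace) (U := C_UniformSpace)
        (fun t : R => c + rho * Cexp (Ci * t))%C f); auto.
      apply Ccontinuous_plus; [apply Ccontinuous_const|].
      apply Ccontinuous_mult; [apply Ccontinuous_const | apply Ccontinuous_Cexp_Ci].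
    + apply Ccontinuous_mult; [apply Ccontinuous_const | apply Ccontinuous_Cexp_Ci].
  - now rewrite Cexp_Ci_0, Cexp_Ci_2PI.
Qed.

(** Continuity of the derivative is part of the notion: differentiation under the integral sign in
    the mean value property relies on it. *)
Definition holomorphic (U : C -> Prop) (f : C -> C) :=
  exists f' : C -> C, forall z, U z ->
    Chas_derivative f z (f' z) /\ Ccontinuous (T := C_UniformSpace) f' z.

(** On the circle [dz / (z - c) = i dt], so this is [i] times the mean value property. *)
Lemma Cauchy_formula (g : C -> C) (c : C) (r0 rho : R) :
  holomorphic (fun z => Cmod (z - c) < r0) g -> 0 < rho < r0 ->
  circle_integral (fun z => g z / (z - c))%C c rho = (2 * PI * Ci * g c)%C.
Proof.
  intros [g' Hg] Hrho. apply circle_integral_unique.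
  replace (2 * PI * Ci * g c)%C with (Ci * (2 * PI * g c))%C by ring.
  eapply (is_RInt_ext (V := C_R_NormedModule));
    [|exact (is_CRInt_mult _ _ _ Ci _ (mean_value g g' c r0 Hg rho Hrho))].
  intros t _. cbv beta. pose proof (Cexp_neq0 (Ci * t)).
  assert (RtoC rho <> RtoC 0) by (intros E; injection E; lra).
  replace (c + rho * Cexp (Ci * t) - c)%C with (rho * Cexp (Ci * t))%C by ring.
  change_eq_C. field. auto.
Qed.

Lemma Cminus_eq_0 (a b : C) : (a - b)%C = RtoC 0 -> a = b.
Proof. intros E. replace a with (a - b + b)%C by ring. rewrite E. ring. Qed.

Section Holomorphic.

Variable U : C -> Prop.
Implicit Types f g : C -> C.

Lemma holomorphic_continuous f z :
  holomorphic U f -> U z -> Ccontinuous (T := C_UniformSpace) f z.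
Proof.
  intros [f' Hf] Hz.
  exact (has_derivative_continuous (T := C_UniformSpace) (fun z => z) _ _ _ (proj1 (Hf z Hz))).
Qed.

Lemma holomorphic_const c : holomorphic U (fun _ => c).
Proof.
  exists (fun _ => RtoC 0). intros z _. split; [apply has_derivative_const | apply Ccontinuous_const].
Qed.

Lemma holomorphic_id : holomorphic U (fun z => z).
Proof.
  exists (fun _ => RtoC 1). intros z _. split; [|apply Ccontinuous_const].
  apply (has_derivative_coord (T := C_UniformSpace) (fun z => z)).
Qed.

Lemma holomorphic_plus f g :
  holomorphic U f -> holomorphic U g -> holomorphic U (fun z => f z + g z)%C.
Proof.
  intros [f' Hf] [g' Hg]. exists (fun z => f' z + g' z)%C. intros z Hz.
  destruct (Hf z Hz), (Hg z Hz). split; [|now apply Ccontinuous_plus].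
  now apply (has_derivative_plus (T := C_UniformSpace) (fun z => z)).
Qed.

Lemma holomorphic_mult f g :
  holomorphic U f -> holomorphic U g -> holomorphic U (fun z => f z * g z)%C.
Proof.
  intros Hf0 Hg0. pose proof (fun z => holomorphic_continuous f z Hf0) as Cf.
  pose proof (fun z => holomorphic_continuous g z Hg0) as Cg.
  destruct Hf0 as [f' Hf], Hg0 as [g' Hg].
  exists (fun z => f' z * g z + f z * g' z)%C. intros z Hz.
  destruct (Hf z Hz), (Hg z Hz). split.
  - now apply (has_derivative_mult (T := C_UniformSpace) (fun z => z)).
  - apply Ccontinuous_plus; apply Ccontinuous_mult; auto.
Qed.

Lemma holomorphic_inv f :
  holomorphic U f -> (forall z, U z -> f z <> RtoC 0) -> holomorphic U (fun z => / f z)%C.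
Proof.
  intros Hf0 N. pose proof (fun z => holomorphic_continuous f z Hf0) as Cf.
  destruct Hf0 as [f' Hf].
  exists (fun z => - f' z / (f z * f z))%C. intros z Hz.
  destruct (Hf z Hz). split.
  - apply (has_derivative_inv (T := C_UniformSpace) (fun z => z)); auto.
  - apply Ccontinuous_mult; [now apply Ccontinuous_opp|].
    apply Ccontinuous_inv; [apply Ccontinuous_mult; auto | apply Cmult_neq_0; auto].
Qed.

Lemma holomorphic_pow f n : holomorphic U f -> holomorphic U (fun z => f z ^ n)%C.
Proof.
  intros Hf. induction n; simpl; [apply holomorphic_const | now apply holomorphic_mult].
Qed.

End Holomorphic.

Lemma circle_distance (c : C) (rho t : R) :
  0 < rho -> Cmod (c + rho * Cexp (Ci * t) - c) = rho.
Proof.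
  intros H. replace (c + rho * Cexp (Ci * t) - c)%C with (rho * Cexp (Ci * t))%C by ring.
  rewrite Cmod_mult, Cmod_R, Cmod_Cexp_Ci, Rabs_pos_eq; lra.
Qed.

(** Cauchy's formula applied to [f z * (z - c)], which vanishes at the centre. *)
Lemma Cauchy_theorem (f : C -> C) (c : C) (r0 rho : R) :
  holomorphic (fun z => Cmod (z - c) < r0) f -> 0 < rho < r0 ->
  circle_integral f c rho = RtoC 0.
Proof.
  intros Hf Hrho.
  rewrite (circle_integral_ext f (fun z => f z * (z - c) / (z - c))%C).
  - rewrite (Cauchy_formula (fun z => f z * (z - c))%C c r0 rho); auto.
    + ring.
    + apply holomorphic_mult; auto.
      apply holomorphic_plus; [apply holomorphic_id | apply holomorphic_const].
  - intros t. field. intros E. pose proof (circle_distance c rho t (proj1 Hrho)) as Hd.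
    rewrite E, Cmod_0 in Hd. lra.
Qed.

Lemma circle_integral_minus (f g : C -> C) (c : C) (rho : R) :
  continuous_on_circle f c rho -> continuous_on_circle g c rho ->
  circle_integral (fun z => f z - g z)%C c rho
  = (circle_integral f c rho - circle_integral g c rho)%C.
Proof.
  intros Hf Hg.
  rewrite (circle_integral_ext _ (fun z => f z + - RtoC 1 * g z)%C) by (intros; ring).
  rewrite (circle_integral_plus f (fun z => - RtoC 1 * g z)%C); auto.
  - rewrite circle_integral_scal; auto. ring.
  - intros t. apply Ccontinuous_mult; [apply Ccontinuous_const | apply Hg].
Qed.

(** * The discrete logarithm on the axes *)

Lemma nat_ind_step2 (P : nat -> Prop) :
  P 0%nat -> P 1%nat -> (forall n, P n -> P (S (S n))) -> forall n, P n.
Proof.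
  intros H0 H1 HS n. enough (P n /\ P (S n)) by tauto.
  induction n as [|n [IH1 IH2]]; auto.
Qed.

Lemma RtoC_INR_S_neq0 n : RtoC (INR (S n)) <> RtoC 0.
Proof. intros E. apply RtoC_inj in E. exact (not_0_INR _ (Nat.neq_succ_0 n) E). Qed.

Section LoopIntegrals.

Variables (theta : C) (gamma rho : R) (L : C -> C).
Hypothesis HL : log_branch theta gamma L.
Hypothesis Hrho : 0 < rho < 1.

Let u (z : C) : C := ((z + theta) / (z - theta))%C.

Definition log_moment (n : nat) : C :=
  circle_integral (fun z => L z / (2 * z) * ((z + theta) / (z - theta)) ^ n)%C theta rho.

(** The integral that remains when an integration by parts differentiates the logarithm in
    [log_moment]. *)
Definition moment (n : nat) : C :=
  circle_integral (fun z => ((z + theta) / (z - theta)) ^ n / z)%C theta rho.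

Let on_circle (z : C) := exists t : R, z = (theta + rho * Cexp (Ci * t))%C.

Lemma on_circle_facts z : on_circle z ->
  z <> RtoC 0 /\ (z - theta)%C <> RtoC 0 /\
  Chas_derivative L z (/ z)%C /\ Ccontinuous (T := C_UniformSpace) L z.
Proof.
  intros [t ->]. pose proof (circle_distance theta rho t (proj1 Hrho)) as Hd.
  set (z := (theta + rho * Cexp (Ci * t))%C) in *.
  assert (Hz : Cmod (z - theta) < 1) by lra. repeat split.
  - now apply (log_branch_neq0 theta gamma L).
  - intros E. rewrite E, Cmod_0 in Hd. lra.
  - now apply (log_branch_derivative theta gamma L).
  - now apply HL.
Qed.

Lemma on_circle_point (t : R) : on_circle (theta + rho * Cexp (Ci * t))%C.
Proof. now exists t. Qed.

Lemma continuous_quotient z : on_circle z -> Ccontinuous (T := C_UniformSpace) u z.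
Proof.
  intros Hz. destruct (on_circle_facts z Hz) as (_ & N & _).
  apply Ccontinuous_mult; [|apply Ccontinuous_inv; auto].
  - apply Ccontinuous_plus; [apply Ccontinuous_id | apply Ccontinuous_const].
  - apply Ccontinuous_minus; [apply Ccontinuous_id | apply Ccontinuous_const].
Qed.

Lemma continuous_moment n : continuous_on_circle (fun z => u z ^ n / z)%C theta rho.
Proof.
  intros t. pose proof (on_circle_point t) as Hz.
  destruct (on_circle_facts _ Hz) as (N & _).
  apply Ccontinuous_mult; [|apply Ccontinuous_inv; [apply Ccontinuous_id|auto]].
  now apply Ccontinuous_pow, continuous_quotient.
Qed.

Lemma continuous_log_moment n :
  continuous_on_circle (fun z => L z / (2 * z) * u z ^ n)%C theta rho.
Proof.
  intros t. pose proof (on_circle_point t) as Hz.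
  destruct (on_circle_facts _ Hz) as (N & _ & _ & HC).
  apply Ccontinuous_mult; [|now apply Ccontinuous_pow, continuous_quotient].
  apply Ccontinuous_mult; auto.
  apply Ccontinuous_inv; [|apply Cmult_neq_0; auto; intros E; injection E; lra].
  apply Ccontinuous_mult; [apply Ccontinuous_const | apply Ccontinuous_id].
Qed.

Lemma derivative_quotient z : on_circle z ->
  Chas_derivative u z (- (2 * theta) / ((z - theta) * (z - theta)))%C.
Proof.
  intros Hz. destruct (on_circle_facts z Hz) as (_ & N & _).
  eapply has_derivative_eq; [|apply (has_derivative_div (T := C_UniformSpace) (fun z => z))].
  2: apply (has_derivative_plus (T := C_UniformSpace) (fun z => z));
     [apply (has_derivative_coord (T := C_UniformSpace) (fun z => z)) | apply has_derivative_const].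
  2: apply (has_derivative_minus (T := C_UniformSpace) (fun z => z));
     [apply (has_derivative_coord (T := C_UniformSpace) (fun z => z)) | apply has_derivative_const].
  2: exact N.
  cbv beta. field. exact N.
Qed.

(* [u^2 - 1 = 4 theta z / (z - theta)^2 = - 2 z u'], so that
   [(u^(n+2) - u^n) / z = - 2 (u^(n+1))' / (n+1)]. *)
Lemma moment_SS n : moment (S (S n)) = moment n.
Proof.
  assert (E : circle_integral (fun z => u z ^ S (S n) / z - u z ^ n / z)%C theta rho = RtoC 0).
  { apply circle_integral_primitive with (F := fun z => (- (2 / INR (S n)) * u z ^ S n)%C).
    - intros t. pose proof (on_circle_point t) as Hz.
      destruct (on_circle_facts _ Hz) as (N & N' & _).
      eapply has_derivative_eq;
        [|apply (has_derivative_scal (T := C_UniformSpace) (fun z => z));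
          apply (has_derivative_pow (T := C_UniformSpace) (fun z => z)), derivative_quotient, Hz].
      pose proof (RtoC_INR_S_neq0 n) as NS.
      unfold u. simpl Cpow. field. auto.
    - intros t. apply Ccontinuous_minus; apply continuous_moment. }
  rewrite circle_integral_minus in E by apply continuous_moment.
  exact (Cminus_eq_0 _ _ E).
Qed.

(** The derivative of [- L * u^(n+1) / (n+1)] integrates to 0. Its part with [u'] is
    [L / (2 z) * (u^(n+2) - u^n)], by the identity for [u^2 - 1] above; its part with [L' = 1 / z]
    gives [moment (S n)]. *)
Lemma log_moment_SS n :
  log_moment (S (S n)) = (log_moment n + moment (S n) / INR (S n))%C.
Proof.
  pose proof (RtoC_INR_S_neq0 n) as NS.
  assert (E : circle_integral (fun z => (L z / (2 * z) * u z ^ S (S n) - L z / (2 * z) * u z ^ n)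
     - / INR (S n) * (u z ^ S n / z))%C theta rho = RtoC 0).
  { apply circle_integral_primitive with (F := fun z => (- / INR (S n) * (L z * u z ^ S n))%C).
    - intros t. pose proof (on_circle_point t) as Hz.
      destruct (on_circle_facts _ Hz) as (N & N' & HD & _).
      eapply has_derivative_eq;
        [|apply (has_derivative_scal (T := C_UniformSpace) (fun z => z));
          apply (has_derivative_mult (T := C_UniformSpace) (fun z => z)); [exact HD|];
          apply (has_derivative_pow (T := C_UniformSpace) (fun z => z)), derivative_quotient, Hz].
      unfold u. simpl Cpow. field. auto.
    - intros t.
      apply Ccontinuous_minus; [apply Ccontinuous_minus; apply continuous_log_moment|].
      apply Ccontinuous_mult; [apply Ccontinuous_const | apply continuous_moment]. }
  rewrite circle_integral_minus in E.
  - rewrite circle_integral_minus in E by apply continuous_log_moment.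
    rewrite circle_integral_scal in E by apply continuous_moment.
    apply Cminus_eq_0 in E.
    change (log_moment (S (S n)) - log_moment n = / INR (S n) * moment (S n))%C in E.
    replace (log_moment (S (S n)))
      with (log_moment n + (log_moment (S (S n)) - log_moment n))%C by ring.
    rewrite E. unfold Cdiv. ring.
  - intros t. apply Ccontinuous_minus; apply continuous_log_moment.
  - intros t. apply Ccontinuous_mult; [apply Ccontinuous_const | apply continuous_moment].
Qed.

Lemma moment_0 : moment 0 = RtoC 0.
Proof.
  unfold moment.
  (* The loop does not wind around 0: [1 / z] has the primitive [L] along it. *)
  apply circle_integral_primitive with (F := L); [|exact (continuous_moment 0)].
  intros t. pose proof (on_circle_point t) as Hz.
  destruct (on_circle_facts _ Hz) as (N & _ & HD & _).
  eapply has_derivative_eq; [|exact HD]. simpl. field. exact N.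
Qed.

Lemma log_moment_0 : log_moment 0 = RtoC 0.
Proof.
  unfold log_moment.
  apply circle_integral_primitive with (F := fun z => (/ 4 * (L z * L z))%C);
    [|exact (continuous_log_moment 0)].
  intros t. pose proof (on_circle_point t) as Hz.
  destruct (on_circle_facts _ Hz) as (N & _ & HD & _).
  eapply has_derivative_eq;
    [|apply (has_derivative_scal (T := C_UniformSpace) (fun z => z));
      apply (has_derivative_mult (T := C_UniformSpace) (fun z => z)); exact HD].
  simpl. field. exact N.
Qed.

Lemma continuous_Cauchy_kernel (g : C -> C) :
  (forall z, on_circle z -> Ccontinuous (T := C_UniformSpace) g z) ->
  continuous_on_circle (fun z => g z / (z - theta))%C theta rho.
Proof.
  intros Hg t. pose proof (on_circle_point t) as Hz.
  destruct (on_circle_facts _ Hz) as (_ & N & _).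
  apply Ccontinuous_mult; auto. apply Ccontinuous_inv; auto.
  apply Ccontinuous_minus; [apply Ccontinuous_id | apply Ccontinuous_const].
Qed.

Lemma holomorphic_log : holomorphic (fun z => Cmod (z - theta) < 1) L.
Proof.
  exists Cinv. intros z Hz. split; [now apply (log_branch_derivative theta gamma L)|].
  apply Ccontinuous_inv; [apply Ccontinuous_id|]. now apply (log_branch_neq0 theta gamma L).
Qed.

(** Partial fractions: [u / z = 2 / (z - theta) - 1 / z], where the last term integrates to
    [moment 0]. *)
Lemma moment_1 : moment 1 = (4 * PI * Ci)%C.
Proof.
  unfold moment.
  rewrite (circle_integral_ext _ (fun z => 2 * (1 / (z - theta)) - u z ^ 0 / z)%C).
  - rewrite circle_integral_minus, circle_integral_scal.
    + rewrite (Cauchy_formula (fun _ => RtoC 1) theta 1 rho); auto using holomorphic_const.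
      fold (moment 0). unfold u. change (circle_integral _ theta rho) with (moment 0).
      rewrite moment_0. ring.
    + apply (continuous_Cauchy_kernel (fun _ => RtoC 1)). intros. apply Ccontinuous_const.
    + intros t. apply Ccontinuous_mult; [apply Ccontinuous_const|].
      apply (continuous_Cauchy_kernel (fun _ => RtoC 1)). intros. apply Ccontinuous_const.
    + apply continuous_moment.
  - intros t. destruct (on_circle_facts _ (on_circle_point t)) as (N & N' & _).
    unfold u. simpl Cpow. field. auto.
Qed.

(** The same partial fractions, weighted by [L / 2]. Cauchy's formula evaluates the branch at the
    centre of the loop, which is where the chosen value [i * gamma] enters. *)
Lemma log_moment_1 : log_moment 1 = (2 * PI * Ci * (Ci * gamma))%C.
Proof.
  unfold log_moment.
  rewrite (circle_integral_ext _ (fun z => L z / (z - theta) - L z / (2 * z) * u z ^ 0)%C).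
  - rewrite circle_integral_minus.
    + rewrite (Cauchy_formula L theta 1 rho); auto using holomorphic_log.
      unfold u. change (circle_integral _ theta rho) with (log_moment 0).
      rewrite log_moment_0, (proj2 HL). ring.
    + apply continuous_Cauchy_kernel. intros z Hz. now apply on_circle_facts.
    + apply continuous_log_moment.
  - intros t. destruct (on_circle_facts _ (on_circle_point t)) as (N & N' & _).
    unfold u. simpl Cpow. field. auto.
Qed.

(** This is the source, on the side of [l], of the parity factor [1 - (-1)^n] in the recursion of
    the axis values. *)
Lemma moment_eq n : moment n = (2 * PI * Ci * (1 - (-1) ^ n)%R)%C.
Proof.
  induction n as [| |n IH] using nat_ind_step2.
  - rewrite moment_0. replace (1 - (-1) ^ 0) with 0 by (simpl; ring). ring.
  - rewrite moment_1. replace (1 - (-1) ^ 1) with 2 by (simpl; ring).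
    replace (RtoC 4) with (2 * 2)%C by (rewrite <- RtoC_mult; f_equal; ring). ring.
  - rewrite moment_SS, IH. do 3 f_equal. simpl. ring.
Qed.

End LoopIntegrals.

(** * The discrete power on the axes *)

(** The axis recursion solved for the next value: with [N = n + 1] and
    [c = (a - 1/2) * (1 - (-1)^N)] it reads [w_(n+2) = w_n * (N + c) / (N - c)]. The factor is 1 for
    even [N] and [(k - 1 + a) / (k - a)] for [N = 2k - 1], as in the explicit product. *)
Fixpoint axis_power (g a : R) (n : nat) : C :=
  match n with
  | 0%nat => RtoC 1
  | 1%nat => Cexp ((2 * a - 1) * (Ci * g))%C
  | S (S m) =>
      (axis_power g a m *
       RtoC ((INR (S m) + (a - 1 / 2) * (1 - (-1) ^ S m))
             / (INR (S m) - (a - 1 / 2) * (1 - (-1) ^ S m))))%C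
  end.

Lemma pow_opp1_cases n : (-1) ^ n = 1 \/ (-1) ^ n = -1.
Proof.
  induction n as [|n [IH|IH]]; simpl;
    [left; ring | right; rewrite IH; ring | left; rewrite IH; ring].
Qed.

Lemma INR_S_ge1 n : 1 <= INR (S n).
Proof. rewrite S_INR. pose proof (pos_INR n). lra. Qed.

(** The correction is 0 or [2a - 1], of absolute value below 1, whereas [INR (S n)] is at least
    1. *)
Lemma axis_coefficient_bound a n : 0 < a < 1 ->
  0 < INR (S n) + (a - 1 / 2) * (1 - (-1) ^ S n) /\
  0 < INR (S n) - (a - 1 / 2) * (1 - (-1) ^ S n).
Proof.
  intros Ha. pose proof (INR_S_ge1 n).
  destruct (pow_opp1_cases (S n)) as [-> | ->]; lra.
Qed.

Lemma axis_power_neq0 g a n : 0 < a < 1 -> axis_power g a n <> RtoC 0.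
Proof.
  intros Ha. induction n as [| |n IH] using nat_ind_step2.
  - apply C1_nz.
  - apply Cexp_neq0.
  - destruct (axis_coefficient_bound a n Ha) as [H1 H2].
    apply Cmult_neq_0; auto. intros E. apply RtoC_inj in E.
    pose proof (Rdiv_lt_0_compat _ _ H1 H2). lra.
Qed.

Lemma power_axis_recurrence (N c w w' : C) :
  (w' + w)%C <> RtoC 0 -> (N - c)%C <> RtoC 0 -> N <> RtoC 0 ->
  (N * ((w' - w) / (w' + w)))%C = c -> w' = (w * ((N + c) / (N - c)))%C.
Proof.
  intros H1 H2 H3 E.
  assert (E' : (N * (w' - w) = c * (w' + w))%C) by (rewrite <- E; field; auto).
  assert (E2 : (w' * (N - c) = w * (N + c))%C).
  { apply Cminus_eq_0. transitivity (N * (w' - w) - c * (w' + w))%C; [ring|].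
    rewrite E'. ring. }
  unfold Cdiv. rewrite Cmult_assoc, <- E2. field. exact H2.
Qed.

Lemma power_axis_data_unique gamma a w : 0 < a < 1 ->
  power_axis_data gamma a w -> forall r n, w (axis r n) = axis_power (gamma r) a n.
Proof.
  intros Ha H r n. destruct (H r) as (H0 & H1 & HS).
  induction n as [| |n IH] using nat_ind_step2; auto.
  destruct (HS (S n)) as [Hn E]; [lia|].
  replace (S n + 1)%nat with (S (S n)) in * by lia.
  replace (S n - 1)%nat with n in * by lia.
  destruct (axis_coefficient_bound a n Ha) as [B1 B2].
  cbn [axis_power]. rewrite <- IH.
  rewrite RtoC_div, RtoC_plus, RtoC_minus by lra.
  apply power_axis_recurrence; auto.
  - rewrite <- RtoC_minus. intros X. apply RtoC_inj in X. lra.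
  - apply RtoC_INR_S_neq0.
Qed.

Lemma axis_power_data gamma a w : 0 < a < 1 ->
  (forall r n, w (axis r n) = axis_power (gamma r) a n) -> power_axis_data gamma a w.
Proof.
  intros Ha H r. rewrite !H. split; [|split]; auto.
  intros n Hn. destruct n as [|n]; [lia|].
  replace (S n + 1)%nat with (S (S n)) by lia.
  replace (S n - 1)%nat with n by lia.
  rewrite !H. destruct (axis_coefficient_bound a n Ha) as [B1 B2].
  pose proof (axis_power_neq0 (gamma r) a n Ha) as Nw.
  pose proof (RtoC_INR_S_neq0 n) as NN.
  cbn [axis_power]. set (w0 := axis_power (gamma r) a n) in *.
  set (c := (a - 1 / 2) * (1 - (-1) ^ S n)) in *.
  assert (ND : (RtoC (INR (S n)) - RtoC c)%C <> RtoC 0).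
  { rewrite <- RtoC_minus. intros X. apply RtoC_inj in X. lra. }
  rewrite RtoC_div, RtoC_plus, RtoC_minus by lra.
  (* The sum [w_(n+2) + w_n] in closed form: it shows that the denominator in the axis data does not
     vanish. *)
  assert (E : (w0 * ((INR (S n) + c) / (INR (S n) - c)) + w0
               = w0 * (2 * INR (S n)) / (INR (S n) - c))%C) by (field; auto).
  assert (N2 : RtoC 2 <> RtoC 0) by (intros X; apply RtoC_inj in X; lra).
  assert (NS : (w0 * (2 * INR (S n)) / (INR (S n) - c))%C <> RtoC 0).
  { intros X. apply (Cmult_neq_0 _ _ Nw (Cmult_neq_0 _ _ N2 NN)).
    replace (w0 * (2 * INR (S n)))%C
      with (w0 * (2 * INR (S n)) / (INR (S n) - c) * (INR (S n) - c))%C by (field; auto).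
    rewrite X. ring. }
  split; [now rewrite E|]. rewrite E. field. auto.
Qed.

Lemma axis_power_half g n : axis_power g (1 / 2) n = RtoC 1.
Proof.
  induction n as [| |n IH] using nat_ind_step2; auto.
  - cbn [axis_power]. replace ((2 * (1 / 2)%R - 1) * (Ci * g))%C with (RtoC 0).
    + apply Cexp_0.
    + rewrite RtoC_div by lra. field.
  - cbn [axis_power]. rewrite IH. pose proof (INR_S_ge1 n).
    replace ((INR (S n) + (1 / 2 - 1 / 2) * (1 - (-1) ^ S n))
      / (INR (S n) - (1 / 2 - 1 / 2) * (1 - (-1) ^ S n))) with 1 by (field; lra).
    ring.
Qed.

Lemma two_PI_Ci_neq0 : (2 * PI * Ci)%C <> RtoC 0.
Proof.
  intros E. apply (f_equal snd) in E. simpl in E.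
  pose proof PI_RGT_0. nra.
Qed.

Lemma axis_power_1_derivative (gamma : R) :
  Rhas_derivative (fun a : R => axis_power gamma a 1) (1 / 2)
    (2 * (Ci * gamma) * Cexp (RtoC 0))%C.
Proof.
  replace (RtoC 0) with ((2 * (1 / 2)%R - 1) * (Ci * gamma))%C.
  2: { rewrite RtoC_div by lra. field. }
  assert (Hl : Rhas_derivative (fun a : R => (2 * a - 1) * (Ci * gamma))%C (1 / 2)
    (2 * (Ci * gamma))%C).
  { eapply has_derivative_eq;
      [|apply (has_derivative_mult (T := R_UniformSpace) RtoC);
        [apply (has_derivative_minus (T := R_UniformSpace) RtoC);
          [apply (has_derivative_scal (T := R_UniformSpace) RtoC),
            (has_derivative_coord (T := R_UniformSpace) RtoC)
          |apply has_derivative_const]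
        |apply has_derivative_const]].
    cbv beta. ring. }
  apply (has_derivative_comp (T := R_UniformSpace) RtoC
    (fun a : R => (2 * a - 1) * (Ci * gamma))%C Cexp); auto.
  + exact (has_derivative_continuous (T := R_UniformSpace) RtoC _ _ _ Hl).
  + apply Chas_derivative_Cexp.
Qed.

Lemma axis_factor_derivative n :
  Rhas_derivative (fun a : R =>
      RtoC ((INR (S n) + (a - 1 / 2) * (1 - (-1) ^ S n))
            / (INR (S n) - (a - 1 / 2) * (1 - (-1) ^ S n))))
    (1 / 2) (RtoC (2 * (1 - (-1) ^ S n) / INR (S n))).
Proof.
  apply is_derive_Rhas_derivative.
  generalize (INR_S_ge1 n). generalize (1 - (-1) ^ S n), (INR (S n)). intros e N HN.
  auto_derive; [lra|]. field. lra.
Qed.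

Lemma axis_power_continuous gamma n :
  Ccontinuous (T := R_UniformSpace) (fun a : R => axis_power gamma a n) (1 / 2).
Proof.
  induction n as [| |n IH] using nat_ind_step2.
  - apply Ccontinuous_const.
  - exact (has_derivative_continuous (T := R_UniformSpace) RtoC _ _ _
      (axis_power_1_derivative gamma)).
  - apply Ccontinuous_mult; [exact IH|].
    exact (has_derivative_continuous (T := R_UniformSpace) RtoC _ _ _
      (axis_factor_derivative n)).
Qed.

(** At [a = 1/2] both factors of [w_(n+2)] equal 1, so their derivatives add, and the rational
    factor contributes [2 * (1 - (-1)^(n+1)) / (n+1)]. By [log_moment_SS] and [moment_eq] the
    right-hand side grows by the same amount. *)
Lemma axis_power_derivative theta gamma rho L n :
  log_branch theta gamma L -> 0 < rho < 1 ->
  Rhas_derivative (fun a : R => axis_power gamma a n) (1 / 2)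
    (2 * (/ (2 * PI * Ci) * log_moment theta rho L n))%C.
Proof.
  intros HL Hrho.
  induction n as [| |n IH] using nat_ind_step2.
  - rewrite (log_moment_0 theta gamma); auto.
    eapply has_derivative_eq;
      [|apply (has_derivative_const (T := R_UniformSpace) RtoC (RtoC 1))]. ring.
  - rewrite (log_moment_1 theta gamma); auto.
    apply has_derivative_eq with (D := (2 * (Ci * gamma) * Cexp (RtoC 0))%C).
    { rewrite Cexp_0. pose proof two_PI_Ci_neq0 as N.
      transitivity (2 * (Ci * gamma) * (/ (2 * PI * Ci) * (2 * PI * Ci)))%C; [|ring].
      rewrite Cinv_l; auto; ring. }
    apply axis_power_1_derivative.
  - rewrite (log_moment_SS theta gamma), (moment_eq theta gamma rho L) by auto.
    pose proof (INR_S_ge1 n) as HN.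
    set (e := 1 - (-1) ^ S n).
    pose proof (axis_factor_derivative n) as Hq. fold e in Hq.
    eapply has_derivative_eq;
      [|exact (has_derivative_mult (T := R_UniformSpace) RtoC _ _ _ _ _ IH Hq)].
    cbv beta. rewrite axis_power_half.
    replace ((INR (S n) + (1 / 2 - 1 / 2) * e) / (INR (S n) - (1 / 2 - 1 / 2) * e))
      with 1 by (field; lra).
    rewrite RtoC_div, RtoC_mult by lra.
    pose proof two_PI_Ci_neq0. pose proof (RtoC_INR_S_neq0 n).
    set (t := (2 * PI * Ci)%C) in *. field. auto.
Qed.

(** * Finite sums and products over a window *)

Lemma window_NoDup d m : NoDup (window d m).
Proof.
  apply NoDup_map_NoDup_ForallPairs; [|apply seq_NoDup]. intros i j _ _. lia.
Qed.

Lemma in_window_In d m r : In r (window d m) <-> in_window d m r.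
Proof.
  unfold window, in_window. rewrite in_map_iff. setoid_rewrite in_seq. split.
  - intros (i & <- & Hi). lia.
  - intros H. exists (Z.to_nat (r - m)). lia.
Qed.

Lemma Csum_ext (f g : Z -> C) s : (forall x, In x s -> f x = g x) -> Csum f s = Csum g s.
Proof.
  unfold Csum. induction s as [|x s IH]; simpl; intros H; auto. f_equal; auto.
Qed.

Lemma Csum_single (f : Z -> C) s r : NoDup s -> In r s ->
  (forall x, In x s -> x <> r -> f x = RtoC 0) -> Csum f s = f r.
Proof.
  unfold Csum. induction 1 as [|x s Hx Hs IH]; simpl; [easy|]. intros [->|Hr] H.
  - replace (fold_right Cplus 0 (map f s)) with (RtoC 0); [ring|].
    assert (forall x, In x s -> f x = RtoC 0).
    { intros x Hxs. apply H; auto. now intros ->. }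
    clear - H0. induction s as [|x s IH]; simpl; auto.
    rewrite <- IH by (intros; apply H0; now right). rewrite H0 by now left. ring.
  - rewrite IH; auto. rewrite (H x); auto; [ring|]. now intros ->.
Qed.

Lemma Csum_plus (f g : Z -> C) s : Csum (fun x => f x + g x)%C s = (Csum f s + Csum g s)%C.
Proof. unfold Csum. induction s; simpl; [|rewrite IHs]; ring. Qed.

Lemma Csum_scal (c : C) (f : Z -> C) s : Csum (fun x => c * f x)%C s = (c * Csum f s)%C.
Proof. unfold Csum. induction s; simpl; [|rewrite IHs]; ring. Qed.

Lemma Cprod_update (f g : Z -> C) (c : C) s r : NoDup s -> In r s ->
  (forall x, x <> r -> f x = g x) -> f r = (c * g r)%C -> Cprod f s = (c * Cprod g s)%C.
Proof.
  intros Hs Hr H Er. induction Hs as [|x s Hx Hs IH]; simpl; [easy|].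
  unfold Cprod in *; simpl. destruct Hr as [->|Hr].
  - rewrite Er.
    rewrite (map_ext_in f g); [ring|]. intros y Hy. apply H. now intros ->.
  - rewrite IH, (H x); auto; [ring|]. now intros ->.
Qed.

Lemma Cprod_single (f : Z -> C) s r : NoDup s -> In r s ->
  (forall x, x <> r -> f x = RtoC 1) -> Cprod f s = f r.
Proof.
  intros Hs Hr H. rewrite (Cprod_update f (fun _ => RtoC 1) (f r) s r); auto; [|ring].
  replace (Cprod (fun _ => RtoC 1) s) with (RtoC 1); [ring|].
  clear. unfold Cprod. induction s; simpl; [|rewrite <- IHs]; ring.
Qed.

Lemma Ccontinuous_Cprod {T : UniformSpace} (f : T -> Z -> C) (s : list Z) (x : T) :
  (forall r, In r s -> Ccontinuous (fun y => f y r) x) ->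
  Ccontinuous (fun y => Cprod (f y) s) x.
Proof.
  unfold Cprod. induction s as [|r s IH]; simpl; intros H; [apply Ccontinuous_const|].
  apply Ccontinuous_mult; auto.
Qed.

(** * Octants *)

Lemma shift_same nu r : shift nu r r = S (nu r).
Proof. unfold shift. now destruct (Z.eq_dec r r). Qed.

Lemma shift_other nu r s : s <> r -> shift nu r s = nu s.
Proof. unfold shift. now destruct (Z.eq_dec s r). Qed.

Lemma axis_same r n : axis r n r = n.
Proof. unfold axis. now destruct (Z.eq_dec r r). Qed.

Lemma axis_other r n s : s <> r -> axis r n s = 0%nat.
Proof. unfold axis. now destruct (Z.eq_dec s r). Qed.

Lemma shift_comm nu j k : shift (shift nu j) k = shift (shift nu k) j.
Proof.
  apply functional_extensionality. intros s. unfold shift.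
  destruct (Z.eq_dec s j), (Z.eq_dec s k); auto.
Qed.

Lemma shift_inj nu mu j : shift nu j = shift mu j -> nu = mu.
Proof.
  intros H. apply functional_extensionality. intros s.
  apply (f_equal (fun f => f s)) in H. unfold shift in H. destruct (Z.eq_dec s j); congruence.
Qed.

Lemma unshift nu j : (0 < nu j)%nat -> exists mu, nu = shift mu j.
Proof.
  intros H. exists (fun s => if Z.eq_dec s j then pred (nu s) else nu s).
  apply functional_extensionality. intros s. unfold shift.
  destruct (Z.eq_dec s j) as [->|]; lia.
Qed.

Section Octant.

Variables (d : nat) (m : Z).

Lemma in_octant_window nu r : in_octant d m nu -> (0 < nu r)%nat -> in_window d m r.
Proof.
  intros H Hr. destruct (classic (in_window d m r)) as [|N]; auto. rewrite H in Hr; auto. lia.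
Qed.

Lemma in_octant_unshift nu j : in_octant d m (shift nu j) -> in_octant d m nu.
Proof. intros H s Hs. specialize (H s Hs). unfold shift in H. destruct (Z.eq_dec s j); lia. Qed.

Lemma in_octant_shift nu j : in_octant d m nu -> in_window d m j -> in_octant d m (shift nu j).
Proof. intros H Hj s Hs. rewrite shift_other; auto. now intros ->. Qed.

Lemma in_octant_shift_window nu j : in_octant d m (shift nu j) -> in_window d m j.
Proof. intros H. apply (in_octant_window _ _ H). rewrite shift_same. lia. Qed.

Definition degree (nu : point) : nat := list_sum (map nu (window d m)).

Lemma degree_shift nu j : in_window d m j -> degree (shift nu j) = S (degree nu).
Proof.
  intros Hj. apply in_window_In in Hj. unfold degree.
  pose proof (window_NoDup d m) as HN. induction HN as [|x s Hx Hs IH]; simpl in *; [easy|].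
  destruct Hj as [->|Hj].
  - rewrite shift_same, (map_ext_in (shift nu j) nu); auto.
    intros y Hy. apply shift_other. now intros ->.
  - rewrite IH by auto. rewrite shift_other; [lia|]. now intros ->.
Qed.

Lemma degree_ind (P : point -> Prop) :
  (forall nu, in_octant d m nu ->
     (forall mu, in_octant d m mu -> (degree mu < degree nu)%nat -> P mu) -> P nu) ->
  forall nu, in_octant d m nu -> P nu.
Proof.
  intros H nu. induction nu as [nu IH] using (well_founded_induction (well_founded_ltof _ degree)).
  intros Hnu. apply H; auto.
Qed.

Lemma octant_cases nu : (1 <= d)%nat -> in_octant d m nu ->
  (exists r n, in_window d m r /\ nu = axis r n) \/
  (exists mu j k, j <> k /\ nu = shift (shift mu j) k).
Proof.
  intros hd H.
  destruct (classic (exists j k, j <> k /\ (0 < nu j)%nat /\ (0 < nu k)%nat)) as [Hjk|Hn].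
  - right. destruct Hjk as (j & k & N & Hj & Hk).
    destruct (unshift nu k Hk) as [nu' ->]. rewrite shift_other in Hj by auto.
    destruct (unshift nu' j Hj) as [mu ->]. now exists mu, j, k.
  - left. destruct (classic (exists r, (0 < nu r)%nat)) as [[r Hr]|H0].
    + exists r, (nu r). split; [now apply (in_octant_window nu)|].
      apply functional_extensionality. intros s. unfold axis. destruct (Z.eq_dec s r) as [->|N]; auto.
      destruct (nu s) eqn:E; auto. elim Hn. exists s, r. repeat split; auto; lia.
    (* The origin lies on every axis; [m] is an index of the window because [1 <= d]. *)
    + exists m, 0%nat. split; [unfold in_window; lia|].
      apply functional_extensionality. intros s. unfold axis.
      destruct (nu s) eqn:E; [now destruct (Z.eq_dec s m)|]. elim H0. exists s. lia.
Qed.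

End Octant.

(** * Distinctness of the directions in an octant *)

(** Equality would give [1 = cos (b - a) = 1 - 2 sin^2 ((b - a) / 2)], but half the difference lies
    strictly between 0 and [PI]. *)
Lemma Cexp_Ci_inj_lt (a b : R) : a < b < a + 2 * PI -> Cexp (Ci * a) <> Cexp (Ci * b).
Proof.
  intros H E.
  assert (E1 : Cexp (Ci * (b - a)%R) = RtoC 1).
  { rewrite RtoC_minus. replace (Ci * (b - a))%C with (Ci * b + - (Ci * a))%C by ring.
    rewrite Cexp_plus, <- E, <- Cexp_plus. rewrite <- Cexp_0. f_equal. ring. }
  assert (E2 : cos (b - a) = 1).
  { apply (f_equal fst) in E1. unfold Cexp in E1; simpl in E1.
    replace (0 * (b - a) - 1 * 0) with 0 in E1 by ring.
    replace (0 * 0 + 1 * (b - a)) with (b - a) in E1 by ring.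
    rewrite exp_0 in E1. lra. }
  replace (b - a) with (2 * ((b - a) / 2)) in E2 by field.
  rewrite cos_2a_sin in E2.
  assert (0 < sin ((b - a) / 2)) by (apply sin_gt_0; lra). nra.
Qed.

Section Directions.

Variables (d : nat) (theta : Z -> C) (gamma : Z -> R).
Hypothesis hd : (1 <= d)%nat.
Hypothesis hdir : directions d theta gamma.

Lemma theta_periodic r q : theta (r + q * (2 * Z.of_nat d))%Z = theta r.
Proof.
  assert (H1 : forall r, theta (r + 2 * Z.of_nat d)%Z = theta r).
  { intros s. replace (s + 2 * Z.of_nat d)%Z with (s + Z.of_nat d + Z.of_nat d)%Z by lia.
    rewrite !(dir_opp _ _ _ hdir). ring. }
  revert r. induction q as [|q IH|q IH] using Z.peano_ind; intros r.
  - f_equal. lia.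
  - rewrite <- (IH r), <- (H1 (r + q * _)%Z). f_equal. lia.
  - rewrite <- (IH r), <- (H1 (r + Z.pred q * _)%Z). f_equal. lia.
Qed.

Lemma theta_distinct_base i j :
  (1 <= i < j)%Z -> (j <= 2 * Z.of_nat d)%Z -> theta i <> theta j.
Proof.
  intros Hij Hj. destruct (dir_order _ _ _ hdir) as (alpha & Ha & Hinc & Hlast).
  assert (Hmono : forall n, (0 <= n)%Z -> forall i, (1 <= i)%Z ->
     (i + n <= Z.of_nat (2 * d))%Z -> alpha i <= alpha (i + n)%Z).
  { intros n Hn. pattern n. apply natlike_ind; auto.
    - intros i0 _ _. rewrite Z.add_0_r. lra.
    - intros x Hx IH i0 Hi0 Hx0. apply Rle_trans with (alpha (i0 + x)%Z).
      + apply IH; lia.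
      + replace (i0 + Z.succ x)%Z with (i0 + x + 1)%Z by lia. left. apply Hinc. lia. }
  rewrite (Ha i), (Ha j) by lia. apply Cexp_Ci_inj_lt. split.
  - apply Rlt_le_trans with (alpha (i + 1)%Z); [apply Hinc; lia|].
    replace j with (i + 1 + (j - i - 1))%Z by lia. apply Hmono; lia.
  - pose proof (Hmono (i - 1)%Z ltac:(lia) 1%Z ltac:(lia) ltac:(lia)) as H1.
    pose proof (Hmono (Z.of_nat (2 * d) - j)%Z ltac:(lia) j ltac:(lia) ltac:(lia)) as H2.
    replace (1 + (i - 1))%Z with i in H1 by lia.
    replace (j + (Z.of_nat (2 * d) - j))%Z with (Z.of_nat (2 * d)) in H2 by lia. lra.
Qed.

(** The circular order concerns the indices [1, ..., 2d] only, so an arbitrary window is first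
    reduced modulo [2d], the period of [theta]. *)
Lemma theta_distinct m j k :
  in_window d m j -> in_window d m k -> j <> k -> theta j <> theta k.
Proof.
  intros Hj Hk N. unfold in_window in *.
  set (P := (2 * Z.of_nat d)%Z). assert (HP : (0 < P)%Z) by lia.
  assert (Hred : forall r, theta r = theta ((r - 1) mod P + 1)%Z).
  { intros r. rewrite <- (theta_periodic ((r - 1) mod P + 1) ((r - 1) / P)). f_equal.
    pose proof (Z.div_mod (r - 1) P). fold P. lia. }
  rewrite (Hred j), (Hred k).
  pose proof (Z.mod_pos_bound (j - 1) P HP). pose proof (Z.mod_pos_bound (k - 1) P HP).
  (* Two indices of a window differ by less than [d], so different indices have different residues
     modulo [2d]. *)
  assert (Hne : ((j - 1) mod P <> (k - 1) mod P)%Z).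
  { intros E. apply N. pose proof (Z.div_mod (j - 1) P ltac:(lia)) as D1.
    pose proof (Z.div_mod (k - 1) P ltac:(lia)) as D2. rewrite E in D1.
    assert ((j - 1) / P = (k - 1) / P)%Z by nia. nia. }
  destruct (Z_lt_le_dec ((j - 1) mod P) ((k - 1) mod P)).
  - apply theta_distinct_base; lia.
  - intros E. symmetry in E. revert E. apply theta_distinct_base; lia.
Qed.

Variable L : Z -> C -> C.
Hypothesis hL : forall r, log_branch (theta r) (gamma r) (L r).

(** * The discrete logarithm in one octant *)

Section DiscreteLog.

Variables (m : Z) (rho : R).
Hypothesis Hrho : small_loops d theta m rho.

Let integrand (nu : point) (s : Z) (z : C) : C :=
  (L s z / (2 * z) *
    Cprod (fun r => Cpow ((z + theta r) / (z - theta r)) (nu r)) (window d m))%C.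

Lemma loop_facts s (t : R) : in_window d m s ->
  let z := (theta s + rho * Cexp (Ci * t))%C in
  z <> RtoC 0 /\ Ccontinuous (T := C_UniformSpace) (L s) z /\
  forall r, in_window d m r -> (z - theta r)%C <> RtoC 0.
Proof.
  intros Hs z. destruct Hrho as [Hr Hsep].
  pose proof (circle_distance (theta s) rho t (proj1 Hr)) as Hd. fold z in Hd.
  assert (Hz : Cmod (z - theta s) < 1) by lra. split; [|split].
  - exact (log_branch_neq0 _ _ _ (hL s) z Hz).
  - now apply (hL s).
  - intros r Hw E. destruct (Z.eq_dec s r) as [->|N].
    + rewrite E, Cmod_0 in Hd. lra.
    + specialize (Hsep s r Hs Hw N). apply Cminus_eq_0 in E. rewrite E in Hd.
      replace (theta r - theta s)%C with (- (theta s - theta r))%C in Hd by ring.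
      rewrite Cmod_opp in Hd. lra.
Qed.

Lemma continuous_integrand nu s : in_window d m s ->
  continuous_on_circle (integrand nu s) (theta s) rho.
Proof.
  intros Hs t. destruct (loop_facts s t Hs) as (N & HC & Hsep).
  apply Ccontinuous_mult.
  - apply Ccontinuous_mult; auto. apply Ccontinuous_inv.
    + apply Ccontinuous_mult; [apply Ccontinuous_const | apply Ccontinuous_id].
    + apply Cmult_neq_0; auto. intros E; apply RtoC_inj in E; lra.
  - apply Ccontinuous_Cprod. intros r Hr. apply in_window_In in Hr.
    apply Ccontinuous_pow, Ccontinuous_mult.
    + apply Ccontinuous_plus; [apply Ccontinuous_id | apply Ccontinuous_const].
    + apply Ccontinuous_inv; auto.
      apply Ccontinuous_minus; [apply Ccontinuous_id | apply Ccontinuous_const].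
Qed.

(** On the axis of [r] the product is the single factor with its pole at [theta r], so the integrand
    is holomorphic inside every other loop. *)
Lemma discrete_log_axis r n : in_window d m r ->
  discrete_log d theta L rho m (axis r n)
  = (/ (2 * PI * Ci) * log_moment (theta r) rho (L r) n)%C.
Proof.
  intros Hr. unfold discrete_log. f_equal.
  assert (Hprod : forall z, Cprod (fun s => Cpow ((z + theta s) / (z - theta s)) (axis r n s))
      (window d m) = Cpow ((z + theta r) / (z - theta r)) n).
  { intros z. rewrite (Cprod_single _ _ r).
    - now rewrite axis_same.
    - apply window_NoDup.
    - now apply in_window_In.
    - intros s N. now rewrite axis_other. }
  rewrite (Csum_single _ _ r).
  - apply circle_integral_ext. intros t. now rewrite Hprod.
  - apply window_NoDup.
  - now apply in_window_In.
  - intros s Hs N. apply in_window_In in Hs. destruct Hrho as [Hr1 Hsep].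
    specialize (Hsep s r Hs Hr N).
    (* In the disc of radius [r0] the branch is defined and the pole [theta r] is excluded;
       [small_loops] places the loop strictly inside it. *)
    set (r0 := Rmin 1 (Cmod (theta s - theta r))).
    rewrite (circle_integral_ext _
      (fun z => L s z * / (2 * z) * ((z + theta r) * / (z - theta r)) ^ n)%C).
    2: { intros t. now rewrite Hprod. }
    apply (Cauchy_theorem _ _ r0).
    2: { split; [lra|]. unfold r0. apply Rmin_glb_lt; lra. }
    assert (Hdisc : forall z, Cmod (z - theta s) < r0 -> Cmod (z - theta s) < 1).
    { intros z Hz. apply Rlt_le_trans with (1 := Hz). apply Rmin_l. }
    apply holomorphic_mult; [apply holomorphic_mult|apply holomorphic_pow, holomorphic_mult].
    + destruct (holomorphic_log _ _ _ (hL s)) as [l' Hl']. exists l'. auto.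
    + apply holomorphic_inv.
      * apply holomorphic_mult; [apply holomorphic_const | apply holomorphic_id].
      * intros z Hz. apply Cmult_neq_0; [intros E; apply RtoC_inj in E; lra|].
        exact (log_branch_neq0 _ _ _ (hL s) z (Hdisc z Hz)).
    + apply holomorphic_plus; [apply holomorphic_id | apply holomorphic_const].
    + apply holomorphic_inv.
      * apply (holomorphic_plus _ (fun z => z) (fun _ => (- theta r)%C));
          [apply holomorphic_id | apply holomorphic_const].
      * intros z Hz E. apply Cminus_eq_0 in E. subst z.
        replace (theta r - theta s)%C with (- (theta s - theta r))%C in Hz by ring.
        rewrite Cmod_opp in Hz. pose proof (Rmin_r 1 (Cmod (theta s - theta r))).
        unfold r0 in Hz. lra.
Qed.

(* With [u_r = (z + theta r) / (z - theta r)], [u_j u_k - 1] and [u_j - u_k] are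
   [2 z (theta j + theta k)] and [2 z (theta k - theta j)], up to sign, over the
   same denominator, so the integrands satisfy the linearized Hirota equation. *)
Lemma discrete_log_hirota nu j k :
  in_window d m j -> in_window d m k -> j <> k ->
  discrete_log d theta L rho m (shift (shift nu j) k)
  = (discrete_log d theta L rho m nu
     + (theta j + theta k) / (theta j - theta k)
       * (discrete_log d theta L rho m (shift nu j)
          - discrete_log d theta L rho m (shift nu k)))%C.
Proof.
  intros Hj Hk N. pose proof (theta_distinct m j k Hj Hk N) as Nt.
  set (kappa := ((theta j + theta k) / (theta j - theta k))%C).
  set (I := fun nu s => circle_integral (integrand nu s) (theta s) rho).
  change (/ (2 * PI * Ci) * Csum (I (shift (shift nu j) k)) (window d m)
    = / (2 * PI * Ci) * Csum (I nu) (window d m)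
      + kappa * (/ (2 * PI * Ci) * Csum (I (shift nu j)) (window d m)
         - / (2 * PI * Ci) * Csum (I (shift nu k)) (window d m)))%C.
  rewrite (Csum_ext _
    (fun s => I nu s + kappa * (I (shift nu j) s + - RtoC 1 * I (shift nu k) s))%C).
  - rewrite Csum_plus, Csum_scal, Csum_plus, Csum_scal. ring.
  - intros s Hs. apply in_window_In in Hs.
    assert (Cj := continuous_integrand (shift nu j) s Hs).
    assert (Ck := continuous_integrand (shift nu k) s Hs).
    assert (Cjk : continuous_on_circle
      (fun z => integrand (shift nu j) s z - integrand (shift nu k) s z)%C (theta s) rho).
    { intros t. apply Ccontinuous_minus; auto. }
    unfold I.
    rewrite (circle_integral_ext _ (fun z => integrand nu s z
      + kappa * (integrand (shift nu j) s z - integrand (shift nu k) s z))%C).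
    + rewrite circle_integral_plus, circle_integral_scal, circle_integral_minus; auto.
      * ring.
      * now apply continuous_integrand.
      * intros t. apply Ccontinuous_mult; [apply Ccontinuous_const | apply Cjk].
    + intros t. destruct (loop_facts s t Hs) as (N0 & _ & Hsep).
      set (z := (theta s + rho * Cexp (Ci * t))%C) in *.
      assert (Hshift : forall mu r, in_window d m r ->
        integrand (shift mu r) s z = ((z + theta r) / (z - theta r) * integrand mu s z)%C).
      { intros mu r Hr. unfold integrand.
        rewrite (Cprod_update _ (fun r => Cpow ((z + theta r) / (z - theta r)) (mu r))
          ((z + theta r) / (z - theta r))%C (window d m) r).
        - ring.
        - apply window_NoDup.
        - now apply in_window_In.
        - intros x Nx. now rewrite shift_other.
        - now rewrite shift_same. }
      rewrite !Hshift; auto. unfold kappa. generalize (integrand nu s z). intros f.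
      field. repeat split; auto. intros E. apply Nt, Cminus_eq_0, E.
Qed.

End DiscreteLog.
End Directions.

(** * Solving the Hirota system *)

(** The value at [n + e_j + e_k] which the Hirota equation assigns to the values
    [w], [w1], [w2] at [n], [n + e_j], [n + e_k]. *)
Definition hirota_step (tj tk w w1 w2 : C) : C :=
  (w * (tk * w2 - tj * w1) / (tk * w1 - tj * w2))%C.

Lemma hirota_stepP tj tk w w1 w2 w12 : (tk * w1 - tj * w2)%C <> RtoC 0 ->
  (tj * w * w1 + tk * w1 * w12 - tj * w12 * w2 - tk * w2 * w)%C = RtoC 0 <->
  w12 = hirota_step tj tk w w1 w2.
Proof.
  intros N. unfold hirota_step. split; intros E.
  - assert (E' : (w12 * (tk * w1 - tj * w2) = w * (tk * w2 - tj * w1))%C).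
    { apply Cminus_eq_0. rewrite <- E. ring. }
    rewrite <- E'. field. exact N.
  - rewrite E. field. exact N.
Qed.

Lemma hirota_step_comm tj tk w w1 w2 : (tk * w1 - tj * w2)%C <> RtoC 0 ->
  hirota_step tj tk w w1 w2 = hirota_step tk tj w w2 w1.
Proof.
  intros N. unfold hirota_step. field. split; auto.
  intros E. apply N. transitivity (- (tj * w2 - tk * w1))%C; [ring|]. rewrite E. ring.
Qed.

Lemma hirota_step_1 tj tk : tj <> tk -> hirota_step tj tk 1 1 1 = RtoC 1.
Proof.
  intros N. unfold hirota_step. field. intros E. apply N. symmetry. apply Cminus_eq_0.
  rewrite <- E. ring.
Qed.

(** The two computations of the top vertex of a cube share the direction [t1] and the value [w23].
    The third face through that vertex is reached later by exchanging directions. *)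
Lemma hirota_step_consistent_3D t1 t2 t3 w w1 w2 w3 :
  let w12 := hirota_step t1 t2 w w1 w2 in
  let w13 := hirota_step t1 t3 w w1 w3 in
  let w23 := hirota_step t2 t3 w w2 w3 in
  (t2 * w1 - t1 * w2)%C <> RtoC 0 -> (t3 * w1 - t1 * w3)%C <> RtoC 0 ->
  (t3 * w2 - t2 * w3)%C <> RtoC 0 ->
  (t2 * w13 - t1 * w23)%C <> RtoC 0 -> (t3 * w12 - t1 * w23)%C <> RtoC 0 ->
  hirota_step t1 t2 w3 w13 w23 = hirota_step t1 t3 w2 w12 w23.
Proof.
  intros w12 w13 w23 N12 N13 N23 M2 M3.
  unfold hirota_step at 1 2.
  (* In cross-multiplied form only the denominators of [w12], [w13], [w23] remain, and the claim is
     an identity of rational functions in [w], [w1], [w2], [w3] and the directions. *)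
  assert (E : (w3 * (t2 * w23 - t1 * w13) * (t3 * w12 - t1 * w23)
             = w2 * (t3 * w23 - t1 * w12) * (t2 * w13 - t1 * w23))%C).
  { clear M2 M3. unfold w12, w13, w23, hirota_step. field. auto. }
  apply Cminus_eq_0.
  transitivity ((w3 * (t2 * w23 - t1 * w13) * (t3 * w12 - t1 * w23)
             - w2 * (t3 * w23 - t1 * w12) * (t2 * w13 - t1 * w23))
             / ((t2 * w13 - t1 * w23) * (t3 * w12 - t1 * w23)))%C.
  - field. auto.
  - rewrite E. field. auto.
Qed.

(** * Curves of values generated from the axes *)

Section Solutions.

Variables (theta : Z -> C) (gamma : Z -> R).

(** A relation and not a function, since a point can be computed along many paths. The resulting
    functions of [a] may differ where a denominator vanishes, division being total, so uniqueness is
    to be expected only near [a = 1/2]. No octant is mentioned: a point common to several octants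
    has the same curves in each. *)
Inductive solution : point -> (R -> C) -> Prop :=
| solution_axis r n : solution (axis r n) (fun a => axis_power (gamma r) a n)
| solution_step nu j k f f1 f2 :
    j <> k -> solution nu f -> solution (shift nu j) f1 -> solution (shift nu k) f2 ->
    solution (shift (shift nu j) k)
      (fun a => hirota_step (theta j) (theta k) (f a) (f1 a) (f2 a)).

Lemma axis_not_step r n nu j k : j <> k -> axis r n <> shift (shift nu j) k.
Proof.
  intros N E. assert (Hs : forall s, s <> r -> shift (shift nu j) k s = 0%nat).
  { intros s Hs. rewrite <- E. now apply axis_other. }
  destruct (Z.eq_dec k r) as [->|Nk].
  - specialize (Hs j N). rewrite shift_other, shift_same in Hs; auto. lia.
  - specialize (Hs k Nk). rewrite shift_same in Hs. lia.
Qed.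

(** No step ends on an axis, so there the curve is determined for every [a], not just as a germ. The
    axis data of a discrete power, imposed on all of [0 < a < 1], require this. *)
Lemma solution_axis_inv r n f :
  solution (axis r n) f -> f = (fun a => axis_power (gamma r) a n).
Proof.
  intros H. remember (axis r n) as nu eqn:E.
  destruct H as [r' n'|nu j k f f1 f2 N]; [|now elim (axis_not_step r n nu j k N)].
  assert (En : forall s, axis r' n' s = axis r n s) by (intros s; now rewrite E).
  destruct (Z.eq_dec r r') as [->|Nr].
  - specialize (En r'). rewrite !axis_same in En. now subst.
  (* A point on two different axes is the origin, where [axis_power] is 1 whatever the angle. *)
  - pose proof (En r) as E1. pose proof (En r') as E2.
    rewrite axis_same, axis_other in E1, E2 by auto. now subst.
Qed.

Variables (d : nat) (m : Z).
Hypothesis hd : (1 <= d)%nat.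
Hypothesis hdir : directions d theta gamma.

Lemma solution_exists nu : in_octant d m nu -> exists f, solution nu f.
Proof.
  revert nu. apply (degree_ind d m). intros nu Hnu IH.
  destruct (octant_cases d m nu hd Hnu) as [(r & n & Hr & ->)|(mu & j & k & N & ->)].
  - eexists. constructor.
  - assert (Hk := in_octant_shift_window d m _ _ Hnu).
    assert (Hmj := in_octant_unshift d m _ _ Hnu).
    assert (Hj := in_octant_shift_window d m _ _ Hmj).
    assert (Hm := in_octant_unshift d m _ _ Hmj).
    assert (Hmk := in_octant_shift d m mu k Hm Hk).
    destruct (IH mu) as [f Hf]; auto; [rewrite !degree_shift by auto; lia|].
    destruct (IH (shift mu j)) as [f1 Hf1]; auto; [rewrite !degree_shift by auto; lia|].
    destruct (IH (shift mu k)) as [f2 Hf2]; auto; [rewrite !degree_shift by auto; lia|].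
    eexists. now apply solution_step with (f := f) (f1 := f1) (f2 := f2).
Qed.

(** Removing a coordinate step does not leave an octant, so all points in the derivation of a
    solution over the [m]-th octant lie in that octant, and its directions are available at each
    step. *)
Lemma solution_octant_ind (P : point -> (R -> C) -> Prop) :
  (forall r n, in_window d m r -> P (axis r n) (fun a => axis_power (gamma r) a n)) ->
  (forall nu j k f f1 f2, in_octant d m nu -> in_window d m j -> in_window d m k -> j <> k ->
     solution nu f -> solution (shift nu j) f1 -> solution (shift nu k) f2 ->
     P nu f -> P (shift nu j) f1 -> P (shift nu k) f2 ->
     P (shift (shift nu j) k)
       (fun a => hirota_step (theta j) (theta k) (f a) (f1 a) (f2 a))) ->
  forall nu f, solution nu f -> in_octant d m nu -> P nu f.
Proof.
  intros Haxis Hstep nu f Hs.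
  induction Hs as [r n|nu j k f f1 f2 N Hf IHf Hf1 IHf1 Hf2 IHf2]; intros Hnu.
  - destruct n as [|n].
    (* The origin may be presented with an index [r] outside the window; it is rewritten with the
       index [m]. *)
    + assert (E : axis r 0 = axis m 0).
      { apply functional_extensionality. intros s. unfold axis.
        now destruct (Z.eq_dec s r), (Z.eq_dec s m). }
      rewrite E. apply (Haxis m 0%nat). unfold in_window. lia.
    + apply Haxis. apply (in_octant_window d m _ _ Hnu). rewrite axis_same. lia.
  - assert (Hk := in_octant_shift_window d m _ _ Hnu).
    assert (Hmj := in_octant_unshift d m _ _ Hnu).
    assert (Hj := in_octant_shift_window d m _ _ Hmj).
    assert (Hm := in_octant_unshift d m _ _ Hmj).
    apply Hstep; auto using in_octant_shift.
Qed.

(** The invariant that keeps denominators away from 0 near [1/2]: they tend to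
    [theta k - theta j]. *)
Definition near_one (f : R -> C) :=
  f (1 / 2) = RtoC 1 /\ Ccontinuous (T := R_UniformSpace) f (1 / 2).

Lemma denominator_neq0 j k (f1 f2 : R -> C) :
  in_window d m j -> in_window d m k -> j <> k -> near_one f1 -> near_one f2 ->
  locally (1 / 2) (fun a => (theta k * f1 a - theta j * f2 a)%C <> RtoC 0).
Proof.
  intros Hj Hk N [E1 C1] [E2 C2].
  apply (Ccontinuous_neq0 (T := R_UniformSpace) (fun a => theta k * f1 a - theta j * f2 a)%C).
  - apply Ccontinuous_minus; apply Ccontinuous_mult; auto; apply Ccontinuous_const.
  - rewrite E1, E2. intros E. apply (theta_distinct d theta gamma hd hdir m j k Hj Hk N).
    symmetry. apply Cminus_eq_0. rewrite <- E. ring.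
Qed.

Lemma solution_near_one nu f : solution nu f -> in_octant d m nu -> near_one f.
Proof.
  revert nu f. apply solution_octant_ind.
  - intros r n _. split; [apply axis_power_half | apply axis_power_continuous].
  - intros nu j k f f1 f2 _ Hj Hk N _ _ _ [E0 C0] [E1 C1] [E2 C2].
    pose proof (theta_distinct d theta gamma hd hdir m j k Hj Hk N) as Nt. split.
    + rewrite E0, E1, E2. now apply hirota_step_1.
    + unfold hirota_step.
      apply Ccontinuous_mult; [apply Ccontinuous_mult; auto|apply Ccontinuous_inv].
      1, 2: apply Ccontinuous_minus; apply Ccontinuous_mult; auto; apply Ccontinuous_const.
      rewrite E1, E2. intros E. apply Nt. symmetry. apply Cminus_eq_0. rewrite <- E. ring.
Qed.

(** The curves at [nu] whose last step uses the directions [j], [k]; uniqueness is proved by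
    comparing different last steps. *)
Definition step_value (nu : point) (j k : Z) (f : R -> C) :=
  exists mu f0 f1 f2, nu = shift (shift mu j) k /\
    solution mu f0 /\ solution (shift mu j) f1 /\ solution (shift mu k) f2 /\
    f = (fun a => hirota_step (theta j) (theta k) (f0 a) (f1 a) (f2 a)).

Lemma locally_eq_trans (f g h : R -> C) :
  locally (1 / 2) (fun a => f a = g a) -> locally (1 / 2) (fun a => g a = h a) ->
  locally (1 / 2) (fun a => f a = h a).
Proof.
  intros H1 H2. generalize (filter_and _ _ H1 H2). apply filter_imp. now intros a [-> ->].
Qed.

(** * Independence of the path of computation *)

Section Uniqueness.

Variable nu : point.
Hypothesis Hnu : in_octant d m nu.
Hypothesis IH : forall mu, in_octant d m mu -> (degree d m mu < degree d m nu)%nat ->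
  forall f g, solution mu f -> solution mu g -> locally (1 / 2) (fun a => f a = g a).

Lemma below_shift mu j : nu = shift mu j ->
  in_window d m j /\ in_octant d m mu /\ (degree d m mu < degree d m nu)%nat.
Proof.
  intros E. rewrite E in Hnu |- *.
  assert (Hj := in_octant_shift_window d m _ _ Hnu).
  assert (Hm := in_octant_unshift d m _ _ Hnu).
  rewrite degree_shift by auto. auto.
Qed.

Lemma step_value_comm j k f : j <> k -> step_value nu j k f ->
  exists g, step_value nu k j g /\ locally (1 / 2) (fun a => f a = g a).
Proof.
  intros N (mu & f0 & f1 & f2 & E & H0 & H1 & H2 & ->).
  exists (fun a => hirota_step (theta k) (theta j) (f0 a) (f2 a) (f1 a)). split.
  - exists mu, f0, f2, f1. rewrite shift_comm. auto.
  - destruct (below_shift _ _ E) as (Hk & Hmj & _).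
    assert (Hj := in_octant_shift_window d m _ _ Hmj).
    assert (Hm := in_octant_unshift d m _ _ Hmj).
    generalize (denominator_neq0 j k f1 f2 Hj Hk N (solution_near_one _ _ H1 Hmj)
      (solution_near_one _ _ H2 (in_octant_shift d m _ _ Hm Hk))).
    apply filter_imp. intros a Ha. now apply hirota_step_comm.
Qed.

(** Equal directions force equal base squares, whose three known vertices have smaller degree. *)
Lemma step_value_same j k f g : j <> k ->
  step_value nu j k f -> step_value nu j k g -> locally (1 / 2) (fun a => f a = g a).
Proof.
  intros N (mu & f0 & f1 & f2 & E & H0 & H1 & H2 & ->)
    (mu' & g0 & g1 & g2 & E' & K0 & K1 & K2 & ->).
  assert (Emu : mu' = mu).
  { rewrite E in E'. now apply shift_inj, shift_inj in E'. }
  subst mu'.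
  destruct (below_shift _ _ E) as (Hk & Hmj & Hlt).
  assert (Hj := in_octant_shift_window d m _ _ Hmj).
  assert (Hm := in_octant_unshift d m _ _ Hmj).
  assert (Hmk := in_octant_shift d m _ _ Hm Hk).
  rewrite degree_shift in Hlt by auto.
  assert (L0 := IH mu Hm ltac:(lia) _ _ H0 K0).
  assert (L1 := IH _ Hmj ltac:(rewrite degree_shift by auto; lia) _ _ H1 K1).
  assert (L2 := IH _ Hmk ltac:(rewrite degree_shift by auto; lia) _ _ H2 K2).
  generalize (filter_and _ _ L0 (filter_and _ _ L1 L2)).
  apply filter_imp. now intros a (-> & -> & ->).
Qed.

(** Two squares ending at [nu] with a common direction [j] span a cube with directions [j], [k],
    [p]; the claim is its consistency, once the values at the lower vertices are identified by the
    induction hypothesis. *)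
Lemma step_value_share j k p f g : j <> k -> j <> p ->
  step_value nu j k f -> step_value nu j p g -> locally (1 / 2) (fun a => f a = g a).
Proof.
  intros Njk Njp Hf Hg.
  destruct (Z.eq_dec k p) as [->|Nkp]; [now apply (step_value_same j p)|].
  destruct Hf as (mu & f0 & f1 & f2 & E & H0 & H1 & H2 & ->).
  destruct Hg as (mu' & g0 & g1 & g2 & E' & K0 & K1 & K2 & ->).
  (* The second step shows that the coordinate [p] of [nu] is positive. As [p] differs from [j] and
     [k], it is positive at [mu] too, and lowering it gives the bottom vertex of the cube. *)
  assert (Hbase : exists b, mu = shift b p /\ mu' = shift b k).
  { assert (Hp : (0 < mu p)%nat).
    { assert (Ep : nu p = mu p) by (rewrite E, !shift_other; auto).
      rewrite <- Ep, E', shift_same. lia. }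
    destruct (unshift mu p Hp) as [b ->]. exists b. split; auto.
    rewrite E, (shift_comm b p j), (shift_comm (shift b j) p k), (shift_comm b j k) in E'.
    symmetry. now apply shift_inj, shift_inj in E'. }
  destruct Hbase as (b & -> & ->).
  destruct (below_shift _ _ E) as (Hk & Hpj & Hlt).
  assert (Hj := in_octant_shift_window d m _ _ Hpj).
  assert (Hbp := in_octant_unshift d m _ _ Hpj).
  assert (Hp := in_octant_shift_window d m _ _ Hbp).
  assert (Hb := in_octant_unshift d m _ _ Hbp).
  rewrite !degree_shift in Hlt by auto.
  assert (Hbj := in_octant_shift d m _ _ Hb Hj).
  assert (Hbk := in_octant_shift d m _ _ Hb Hk).
  (* One reference curve is fixed at each of the seven vertices below [nu]: four chosen, and three
     computed from them by [hirota_step]. The curves in the two given steps have the same germs at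
     [1/2], their points having smaller degree than [nu]. *)
  destruct (solution_exists b Hb) as [w Sw].
  destruct (solution_exists _ Hbj) as [w1 Sw1].
  destruct (solution_exists _ Hbk) as [w2 Sw2].
  destruct (solution_exists _ Hbp) as [w3 Sw3].
  pose proof (solution_step _ _ _ _ _ _ Njk Sw Sw1 Sw2) as S12.
  pose proof (solution_step _ _ _ _ _ _ Njp Sw Sw1 Sw3) as S13.
  pose proof (solution_step _ _ _ _ _ _ Nkp Sw Sw2 Sw3) as S23.
  set (w12 := fun a => hirota_step (theta j) (theta k) (w a) (w1 a) (w2 a)) in *.
  set (w13 := fun a => hirota_step (theta j) (theta p) (w a) (w1 a) (w3 a)) in *.
  set (w23 := fun a => hirota_step (theta k) (theta p) (w a) (w2 a) (w3 a)) in *.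
  assert (Hbjk := in_octant_shift d m _ _ Hbj Hk).
  assert (Hbjp := in_octant_shift d m _ _ Hbj Hp).
  assert (Hbkp := in_octant_shift d m _ _ Hbk Hp).
  rewrite (shift_comm b p j) in H1. rewrite (shift_comm b p k) in H2.
  rewrite (shift_comm b k j) in K1.
  assert (L0 := IH _ Hbp ltac:(rewrite !degree_shift by auto; lia) _ _ H0 Sw3).
  assert (L1 := IH _ Hbjp ltac:(rewrite !degree_shift by auto; lia) _ _ H1 S13).
  assert (L2 := IH _ Hbkp ltac:(rewrite !degree_shift by auto; lia) _ _ H2 S23).
  assert (M0 := IH _ Hbk ltac:(rewrite !degree_shift by auto; lia) _ _ K0 Sw2).
  assert (M1 := IH _ Hbjk ltac:(rewrite !degree_shift by auto; lia) _ _ K1 S12).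
  assert (M2 := IH _ Hbkp ltac:(rewrite !degree_shift by auto; lia) _ _ K2 S23).
  pose proof (solution_near_one _ _ Sw1 Hbj) as O1.
  pose proof (solution_near_one _ _ Sw2 Hbk) as O2.
  pose proof (solution_near_one _ _ Sw3 Hbp) as O3.
  pose proof (solution_near_one _ _ S12 Hbjk) as O12.
  pose proof (solution_near_one _ _ S13 Hbjp) as O13.
  pose proof (solution_near_one _ _ S23 Hbkp) as O23.
  generalize (filter_and _ _ (filter_and _ _ L0 (filter_and _ _ L1 L2))
    (filter_and _ _ (filter_and _ _ M0 (filter_and _ _ M1 M2))
    (filter_and _ _ (filter_and _ _ (denominator_neq0 j k w1 w2 Hj Hk Njk O1 O2)
       (filter_and _ _ (denominator_neq0 j p w1 w3 Hj Hp Njp O1 O3)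
          (denominator_neq0 k p w2 w3 Hk Hp Nkp O2 O3)))
      (filter_and _ _ (denominator_neq0 j k w13 w23 Hj Hk Njk O13 O23)
         (denominator_neq0 j p w12 w23 Hj Hp Njp O12 O23))))).
  apply filter_imp. intros a ((-> & -> & ->) & (-> & -> & ->) & (D1 & D2 & D3) & D4 & D5).
  now apply hirota_step_consistent_3D.
Qed.

Lemma step_value_exists j k : j <> k -> (0 < nu j)%nat -> (0 < nu k)%nat ->
  exists f, step_value nu j k f.
Proof.
  intros N Hj Hk. destruct (unshift nu k Hk) as [nu' E].
  assert (Hj' : (0 < nu' j)%nat) by (rewrite E, shift_other in Hj; auto).
  destruct (unshift nu' j Hj') as [mu ->].
  destruct (below_shift _ _ E) as (Wk & Hmj & _).
  assert (Hm := in_octant_unshift d m _ _ Hmj).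
  destruct (solution_exists _ Hm) as [f0 S0].
  destruct (solution_exists _ Hmj) as [f1 S1].
  destruct (solution_exists _ (in_octant_shift d m _ _ Hm Wk)) as [f2 S2].
  eexists. exists mu, f0, f1, f2. repeat split; auto.
Qed.

(** The chain of last steps [(j, k)], [(j, p)], [(p, j)], [(p, q)]: its middle link is an exchange,
    while the outer links share a direction. The intermediate pair is available because both its
    coordinates are positive. *)
Lemma step_value_unique j k p q f g : j <> k -> p <> q ->
  step_value nu j k f -> step_value nu p q g -> locally (1 / 2) (fun a => f a = g a).
Proof.
  intros Njk Npq Hf Hg.
  destruct (Z.eq_dec j p) as [->|Njp]; [now apply (step_value_share p k q)|].
  assert (Hj : (0 < nu j)%nat).
  { destruct Hf as (mu & _ & _ & _ & -> & _). rewrite shift_other, shift_same by auto. lia. }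
  assert (Hp : (0 < nu p)%nat).
  { destruct Hg as (mu & _ & _ & _ & -> & _). rewrite shift_other, shift_same by auto. lia. }
  destruct (step_value_exists j p Njp Hj Hp) as [h Hh].
  destruct (step_value_comm j p h Njp Hh) as (h' & Hh' & Ehh').
  apply locally_eq_trans with h; [now apply (step_value_share j k p)|].
  apply locally_eq_trans with h'; auto. apply (step_value_share p j q); auto.
Qed.

End Uniqueness.

Lemma solution_cases nu f : solution nu f ->
  (exists r n, nu = axis r n) \/ exists j k, j <> k /\ step_value nu j k f.
Proof.
  intros [r n|mu j k f0 f1 f2 N H0 H1 H2]; [left; eauto|right].
  exists j, k. split; auto. exists mu, f0, f1, f2. auto.
Qed.

Lemma solution_unique nu f g : in_octant d m nu -> solution nu f -> solution nu g ->
  locally (1 / 2) (fun a => f a = g a).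
Proof.
  intros Hnu. revert nu Hnu f g. apply (degree_ind d m (fun nu => forall f g,
    solution nu f -> solution nu g -> locally (1 / 2) (fun a => f a = g a))).
  intros nu Hnu IH f g Hf Hg.
  assert (Haxis : forall r n, nu = axis r n -> locally (1 / 2) (fun a => f a = g a)).
  { intros r n ->. apply solution_axis_inv in Hf, Hg. subst. now apply filter_forall. }
  destruct (solution_cases _ _ Hf) as [(r & n & E)|(j & k & Njk & Sf)]; eauto.
  destruct (solution_cases _ _ Hg) as [(r & n & E)|(p & q & Npq & Sg)]; eauto.
  apply (step_value_unique nu Hnu IH j k p q); auto.
Qed.

(** A derivation of [f] uses finitely many steps, so only finitely many neighbourhoods of [1/2] are
    intersected; on them each Hirota equation can be solved for the last vertex. *)
Lemma discrete_power_solution w : discrete_power d theta gamma w ->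
  forall nu f, solution nu f -> in_octant d m nu -> locally (1 / 2) (fun a => w a nu = f a).
Proof.
  intros [Hax Hhir]. apply solution_octant_ind.
  - intros r n _.
    assert (Hopen : locally (1 / 2) (fun a => 0 < a < 1)).
    { apply (filter_and (F := locally (1 / 2)) (fun a => 0 < a) (fun a => a < 1));
        [apply (open_gt 0) | apply (open_lt 1)]; lra. }
    apply filter_imp with (2 := Hopen). intros a Ha.
    now apply power_axis_data_unique; [|apply Hax].
  - intros nu j k f f1 f2 Hnu Hj Hk N S0 S1 S2 E0 E1 E2.
    pose proof (denominator_neq0 j k f1 f2 Hj Hk N
      (solution_near_one _ _ S1 (in_octant_shift d m _ _ Hnu Hj))
      (solution_near_one _ _ S2 (in_octant_shift d m _ _ Hnu Hk))) as HD.
    generalize (filter_and _ _ (Hhir m nu j k Hnu Hj Hk N)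
      (filter_and _ _ HD (filter_and _ _ E0 (filter_and _ _ E1 E2)))).
    apply filter_imp. intros a (H & D & A0 & A1 & A2).
    unfold hirota_eq in H. rewrite A0, A1, A2 in H. now apply hirota_stepP.
Qed.

(** At values 1 the quotient contributes [((tk * D2 - tj * D1) - (tk * D1 - tj * D2)) / (tk - tj)],
    which is the stated multiple of [D1 - D2]. *)
Lemma hirota_step_derivative tj tk (f f1 f2 : R -> C) D D1 D2 : tj <> tk ->
  near_one f -> near_one f1 -> near_one f2 ->
  Rhas_derivative f (1 / 2) D -> Rhas_derivative f1 (1 / 2) D1 ->
  Rhas_derivative f2 (1 / 2) D2 ->
  Rhas_derivative (fun a : R => hirota_step tj tk (f a) (f1 a) (f2 a)) (1 / 2)
    (D + (tj + tk) / (tj - tk) * (D1 - D2))%C.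
Proof.
  intros N [E0 _] [E1 _] [E2 _] H0 H1 H2. unfold hirota_step.
  assert (N1 : (tj - tk)%C <> RtoC 0) by (intros E; apply N, Cminus_eq_0, E).
  assert (N2 : (tk - tj)%C <> RtoC 0) by (intros E; apply N; symmetry; apply Cminus_eq_0, E).
  eapply has_derivative_eq.
  2: { apply (has_derivative_div (T := R_UniformSpace) RtoC
         (fun a : R => f a * (tk * f2 a - tj * f1 a))%C (fun a : R => tk * f1 a - tj * f2 a)%C).
    - apply (has_derivative_mult (T := R_UniformSpace) RtoC); [exact H0|].
      apply (has_derivative_minus (T := R_UniformSpace) RtoC);
        apply (has_derivative_scal (T := R_UniformSpace) RtoC); [exact H2 | exact H1].
    - apply (has_derivative_minus (T := R_UniformSpace) RtoC);
        apply (has_derivative_scal (T := R_UniformSpace) RtoC); [exact H1 | exact H2].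
    - rewrite E1, E2, !Cmult_1_r. exact N2. }
  cbv beta. rewrite E0, E1, E2. field. split; auto.
Qed.

Lemma solution_derivative L rho :
  (forall r, log_branch (theta r) (gamma r) (L r)) -> small_loops d theta m rho ->
  forall nu f, solution nu f -> in_octant d m nu ->
  Rhas_derivative f (1 / 2) (2 * discrete_log d theta L rho m nu)%C.
Proof.
  intros hL Hrho. apply solution_octant_ind.
  - intros r n Hr. rewrite (discrete_log_axis d theta gamma L hL m rho Hrho r n Hr).
    apply (axis_power_derivative (theta r)); [apply hL | apply Hrho].
  - intros nu j k f f1 f2 Hnu Hj Hk N S0 S1 S2 D0 D1 D2.
    pose proof (theta_distinct d theta gamma hd hdir m j k Hj Hk N) as Nt.
    rewrite (discrete_log_hirota d theta gamma hd hdir L hL m rho Hrho nu j k Hj Hk N).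
    eapply has_derivative_eq;
      [|apply (hirota_step_derivative _ _ _ _ _ _ _ _ Nt
         (solution_near_one _ _ S0 Hnu)
         (solution_near_one _ _ S1 (in_octant_shift d m _ _ Hnu Hj))
         (solution_near_one _ _ S2 (in_octant_shift d m _ _ Hnu Hk)) D0 D1 D2)].
    ring.
Qed.

End Solutions.

(** One curve is chosen at each point, without coherence between the choices. The step from the
    curves at three vertices of a square is another solution at the fourth, so by uniqueness it has
    the germ of the curve chosen there, which is the Hirota equation near [1/2]. *)
Lemma discrete_power_exists d theta gamma :
  (1 <= d)%nat -> directions d theta gamma -> exists w, discrete_power d theta gamma w.
Proof.
  intros hd hdir.
  (* The choice depends on the point alone and not on an octant; at a point without solution it is
     arbitrary. *)
  set (F := fun nu => epsilon (inhabits (fun _ => RtoC 0)) (solution theta gamma nu)).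
  assert (HF : forall nu, (exists f, solution theta gamma nu f) -> solution theta gamma nu (F nu)).
  { intros nu. apply epsilon_spec. }
  exists (fun a nu => F nu a). split.
  (* On the axes there is only one curve to choose, hence the data hold for every [a] in
     [(0, 1)]. *)
  - intros a Ha. apply axis_power_data; auto. intros r n.
    rewrite (solution_axis_inv theta gamma r n (F (axis r n))); auto.
    apply HF. eexists. constructor.
  - intros m nu j k Hnu Hj Hk N.
    assert (Hnuj := in_octant_shift d m _ _ Hnu Hj).
    assert (Hnuk := in_octant_shift d m _ _ Hnu Hk).
    assert (Hnujk := in_octant_shift d m _ _ Hnuj Hk).
    assert (HS : forall mu, in_octant d m mu -> solution theta gamma mu (F mu)).
    { intros mu Hmu. now apply HF, (solution_exists theta gamma d m hd). }
    pose proof (solution_step theta gamma _ _ _ _ _ _ N (HS _ Hnu) (HS _ Hnuj) (HS _ Hnuk)) as S12.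
    pose proof (solution_unique theta gamma d m hd hdir _ _ _ Hnujk (HS _ Hnujk) S12) as E.
    pose proof (denominator_neq0 theta gamma d m hd hdir j k _ _ Hj Hk N
      (solution_near_one theta gamma d m hd hdir _ _ (HS _ Hnuj) Hnuj)
      (solution_near_one theta gamma d m hd hdir _ _ (HS _ Hnuk) Hnuk)) as HD.
    generalize (filter_and _ _ E HD). apply filter_imp. intros a [Ea Da].
    now apply hirota_stepP.
Qed.

Theorem theorem6p20 (d : nat) (theta : Z -> C) (gamma : Z -> R) (L : Z -> C -> C)
  (hd : (1 <= d)%nat)
  (hdir : directions d theta gamma)
  (hL : forall r, log_branch (theta r) (gamma r) (L r)) :
  (exists w : R -> point -> C, discrete_power d theta gamma w) /\
  (forall w1 w2 : R -> point -> C,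
     discrete_power d theta gamma w1 -> discrete_power d theta gamma w2 ->
     forall nu, in_cover d nu -> locally (1 / 2) (fun a => w1 a nu = w2 a nu)) /\
  (forall w : R -> point -> C, discrete_power d theta gamma w ->
     (forall nu, in_cover d nu -> w (1 / 2) nu = RtoC 1) /\
     (forall m nu rho, in_octant d m nu -> small_loops d theta m rho ->
        exists D : C,
          is_derive (K := R_AbsRing) (V := C_R_NormedModule)
            (fun a => w a nu) (1 / 2) D /\
          discrete_log d theta L rho m nu = (1 / 2 * D)%C)).
Proof.
  split; [|split].
  - now apply discrete_power_exists.
  - intros w1 w2 H1 H2 nu [m Hnu].
    destruct (solution_exists theta gamma d m hd nu Hnu) as [f Hf].
    generalize (filter_and _ _
      (discrete_power_solution theta gamma d m hd hdir w1 H1 nu f Hf Hnu)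
      (discrete_power_solution theta gamma d m hd hdir w2 H2 nu f Hf Hnu)).
    apply filter_imp. now intros a [-> ->].
  - intros w Hw. split.
    + intros nu [m Hnu]. destruct (solution_exists theta gamma d m hd nu Hnu) as [f Hf].
      pose proof (discrete_power_solution theta gamma d m hd hdir w Hw nu f Hf Hnu) as E.
      apply locally_singleton in E. rewrite E.
      apply (solution_near_one theta gamma d m hd hdir nu f Hf Hnu).
    + intros m nu rho Hnu Hrho.
      destruct (solution_exists theta gamma d m hd nu Hnu) as [f Hf].
      exists (2 * discrete_log d theta L rho m nu)%C. split.
      * apply has_derivative_is_derive.
        apply (has_derivative_ext_loc (T := R_UniformSpace) RtoC f).
        -- generalize (discrete_power_solution theta gamma d m hd hdir w Hw nu f Hf Hnu).
           apply filter_imp. now intros a ->.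
        -- now apply (solution_derivative theta gamma d m hd hdir L rho hL Hrho).
      * field.
Qed.
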